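(* Let $\Delta$ be a simplicial complex on the vertex set $[n]$ and let $\Delta^e$ be its exterior shifting. Then for all $1\le l\le n$ and $j\in\mathbb{Z}$, $$\alpha_{l,j}(E/J_{\Delta})=|\{u\in G(I_{\Delta^e})_{j+1}:\min(u)=l\}|=|\{u\in G(J_{\Delta^e})_{j+1}:\min(u)=l\}|.$$ In particular, for all $i\ge 1$ and $j\in\mathbb{Z}$, $$\beta^S_{i,i+j}(K[\Delta^e])=\sum_{l=1}^n \binom{n-l-j}{i-1}\alpha_{l,j}(K\{\Delta\}).$$
   Context: $K$ is an infinite field, $S=K[x_1,\dots,x_n]$ is the polynomial ring and $E=K\langle e_1,\ldots,e_n\rangle$ is the exterior algebra, both standard graded. A simplicial complex $\Delta$ on $[n]=\{1,\dots,n\}$ is a collection of subsets of $[n]$ closed under taking subsets; it is always assumed that $\{i\}\in\Delta$ for all $i\in[n]$. For $F=\{i_1<\dots<i_r\}$ put $x_F=x_{i_1}\cdots x_{i_r}$ and $e_F=e_{i_1}\wedge\dots\wedge e_{i_r}$. Put $K[\Delta]=S/I_\Delta$ with $I_\Delta=(x_F:F\subseteq[n],F\notin\Delta)$ and $K\{\Delta\}=E/J_\Delta$ with $J_\Delta=(e_F:F\subseteq[n],F\notin\Delta)$. $\beta^S_{i,j}$ are the graded Betti numbers over $S$. For a monomial ideal $I$ in $S$ or $E$, $G(I)$ is its unique minimal set of monomial generators and $G(I)_j$ the subset of those of degree $j$. For a monomial $u$, $\min(u)$ is the smallest $i$ such that $x_i$ (resp. $e_i$) divides $u$. For a graded $E$-module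 $M$ and $v\in E_1$, $H^j(M,v)$ denotes the homology at $M_j$ of the complex $\cdots\to M_{j-1}\xrightarrow{\cdot v}M_j\xrightarrow{\cdot v}M_{j+1}\to\cdots$. For a basis $v_1,\dots,v_n$ of $E_1$ put $\alpha_{i,j}(v_1,\dots,v_n;M)=\dim_KH^j(M/(v_1,\dots,v_{i-1})M,v_i)$ for $1\le i\le n$, $j\in\mathbb{Z}$. For a graded ideal $J\subseteq E$, the exterior generic annihilator numbers of $E/J$ are $$\alpha_{i,j}(E/J)=\alpha_{i,j}(e_1,\dots,e_n;E/\operatorname{gin}_{<_{\mathrm{rlex}}}(J)).$$ Here $<_{\mathrm{rlex}}$ is the reverse lexicographic order with respect to $e_1<\dots<e_n$ (among monomials of the same degree, $e_A<_{\mathrm{rlex}}e_B$ iff $\min((A\setminus B)\cup(B\setminus A))\in A$), and $\operatorname{gin}_{<_{\mathrm{rlex}}}(J)$ is the generic initial ideal, i.e. the common value of $\operatorname{in}_{<_{\mathrm{rlex}}}(\varphi(J))$ for $\varphi$ in a suitable non-empty Zariski-open subset of $\mathrm{GL}_n(K)$. Exterior algebraic shifting: let $K'/K$ be a field extension containing elements $a_{ij}$, $1\le i,j\le n$, algebraically independent over $K$, let $f_i=\sum_{j=1}^na_{ij}e_j\in K'\otimes_KE$, and for $A=\{i_1<\dots<i_k\}$ let $f_A=f_{i_1}\wedge\dots\wedge f_{i_k}$ with image $\bar f_A$ in $K'\{\Delta\}$. For sets of equal size let $A<_{\mathrm{lex}}B$ iff $\min((A\setminus B)\cup(B\setminus A))\in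 A$. The exterior shifting of $\Delta$ is the simplicial complex $$\Delta^e=\bigcup_{i=0}^{\dim\Delta+1}\Big\{A\subseteq[n]:|A|=i,\ \bar f_A\notin\operatorname{span}_{K'}\{\bar f_{A'}:|A'|=i,\ A'<_{\mathrm{lex}}A\}\Big\}.$$ It satisfies $J_{\Delta^e}=\operatorname{gin}_{<_{\mathrm{rlex}}}(J_\Delta)$. *)

(* Defs.v *)
From HB Require Import structures.
From mathcomp Require Import finmap boolp classical_sets cardinality.
From mathcomp Require Import all_boot all_order all_algebra all_field.
From mathcomp Require Import mpoly.
Set Implicit Arguments.
Unset Strict Implicit.
Unset Printing Implicit Defensive.
Import Order.TTheory GRing.Theory Num.Theory.
Local Open Scope ring_scope.

(* The exterior algebra on e_0, ..., e_(n-1): x A is the coefficient of e_A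
   in x, where e_A is the product of the e_i, i in A, in increasing order. The
   generators and vertices are indexed by 'I_n, so they start at 0. *)
Definition extalg (K : fieldType) (n : nat) := {ffun {set 'I_n} -> K^o}.
HB.instance Definition _ (K : fieldType) n :=
  Vector.copy (extalg K n) {ffun {set 'I_n} -> K^o}.

Section ExteriorAlgebra.
Variables (K : fieldType) (n : nat).
Local Notation E := (extalg K n).
Implicit Types (A B C : {set 'I_n}) (x y z : E).

Definition emon A : E := [ffun B => (B == A)%:R].

(* e_A e_B = esign A B *: e_(A :|: B), the exponent being the number of
   transpositions needed to sort A followed by B. *)
Definition inversions A B : nat := (\sum_(i in A) \sum_(j in B) (j < i))%N.

Definition esign A B : K :=
  if [disjoint A & B] then (-1) ^+ inversions A B else 0.

Definition extmul x y : E :=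
  \sum_A \sum_B (x A * y B * esign A B) *: emon (A :|: B).

Lemma extalgE x : x = \sum_A x A *: emon A.
Proof.
apply/ffunP => B; rewrite sum_ffunE (bigD1 B) //= !ffunE eqxx big1 => [|A AB].
  by rewrite addr0 /GRing.scale /= mulr1.
by rewrite !ffunE eq_sym (negbTE AB) scaler0.
Qed.

Lemma extmul_is_linear_l y : linear (extmul^~ y).
Proof.
move=> a u v; rewrite /extmul scaler_sumr -big_split; apply: eq_bigr => A _ /=.
rewrite scaler_sumr -big_split; apply: eq_bigr => B _ /=.
by rewrite scalerA -scalerDl !ffunE /GRing.scale /= !mulrDl !mulrA.
Qed.

Lemma extmul_is_linear_r x : linear (extmul x).
Proof.
move=> a u v; rewrite /extmul scaler_sumr -big_split; apply: eq_bigr => A _ /=.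
rewrite scaler_sumr -big_split; apply: eq_bigr => B _ /=.
rewrite scalerA -scalerDl !ffunE /GRing.scale /= mulrDr mulrDl.
by rewrite !mulrA (mulrC (x A) a).
Qed.

Definition extmulr y x := extmul x y.

HB.instance Definition _ y :=
  GRing.isLinear.Build K E E *:%R (extmulr y) (extmul_is_linear_l y).
HB.instance Definition _ x :=
  GRing.isLinear.Build K E E *:%R (extmul x) (extmul_is_linear_r x).

Lemma extmul_suml (I : finType) (F : I -> E) y :
  extmul (\sum_i F i) y = \sum_i extmul (F i) y.
Proof. exact: (raddf_sum (extmulr y)). Qed.

Lemma extmul_sumr (I : finType) (F : I -> E) x :
  extmul x (\sum_i F i) = \sum_i extmul x (F i).
Proof. exact: (raddf_sum (extmul x)). Qed.

Lemma extmulZl a x y : extmul (a *: x) y = a *: extmul x y.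
Proof. exact: (linearZZ (extmulr y)). Qed.

Lemma extmulZr a x y : extmul x (a *: y) = a *: extmul x y.
Proof. exact: (linearZZ (extmul x)). Qed.

Lemma extmul_mon A B : extmul (emon A) (emon B) = esign A B *: emon (A :|: B).
Proof.
rewrite /extmul (bigD1 A) //= (bigD1 B) //= !ffunE !eqxx !mul1r.
rewrite big1 ?addr0 => [|D DB].
  rewrite big1 ?addr0 // => C CA.
  by rewrite big1 // => D _; rewrite !ffunE (negbTE CA) !mul0r scale0r.
by rewrite !ffunE (negbTE DB) mulr0 mul0r scale0r.
Qed.

Lemma big_disjU A B (F : 'I_n -> nat) : [disjoint A & B] ->
  (\sum_(i in A :|: B) F i = \sum_(i in A) F i + \sum_(i in B) F i)%N.
Proof.
by move=> dAB; rewrite -bigU //; apply: eq_bigl => i; rewrite !inE.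
Qed.

Lemma inversionsUl A B C : [disjoint A & B] ->
  inversions (A :|: B) C = (inversions A C + inversions B C)%N.
Proof. exact: big_disjU. Qed.

Lemma inversionsUr A B C : [disjoint B & C] ->
  inversions A (B :|: C) = (inversions A B + inversions A C)%N.
Proof.
move=> dAB; rewrite /inversions -big_split; apply: eq_bigr => i _.
exact: big_disjU.
Qed.

Lemma esign_cocycle A B C :
  esign A B * esign (A :|: B) C = esign B C * esign A (B :|: C).
Proof.
rewrite /esign -!setI_eq0 setIUl setIUr !setU_eq0.
have [dAB|_] := eqVneq (A :&: B) set0; last by rewrite !mul0r /= mulr0.
have [dAC|_] := eqVneq (A :&: C) set0; last by rewrite !mulr0.
have [dBC|_] := eqVneq (B :&: C) set0; last by rewrite mulr0 mul0r.
rewrite /= -!exprD inversionsUl ?inversionsUr -?setI_eq0 ?dAB ?dBC //.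
by rewrite addnA addnC.
Qed.

Lemma extmulA : associative extmul.
Proof.
move=> x y z; rewrite [x]extalgE.
rewrite [LHS]extmul_suml [extmul _ y]extmul_suml [RHS]extmul_suml.
apply: eq_bigr => A _; rewrite extmulZl [extmul _ y]extmulZl extmulZl.
congr (_ *: _); rewrite [y]extalgE.
rewrite [extmul _ z]extmul_suml [LHS]extmul_sumr.
rewrite [extmul (emon A) _]extmul_sumr [RHS]extmul_suml.
apply: eq_bigr => B _; rewrite [extmul _ z]extmulZl [LHS]extmulZr.
rewrite [extmul (emon A) (_ *: _)]extmulZr [RHS]extmulZl.
congr (_ *: _); rewrite [z]extalgE.
rewrite [extmul (emon B) _]extmul_sumr [LHS]extmul_sumr [RHS]extmul_sumr.
apply: eq_bigr => C _; rewrite [extmul (emon B) (_ *: _)]extmulZr.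
rewrite [LHS]extmulZr [RHS]extmulZr; congr (_ *: _).
rewrite !extmul_mon extmulZr extmulZl !extmul_mon !scalerA setUA.
by rewrite esign_cocycle.
Qed.

Lemma inversions0l A : inversions set0 A = 0%N.
Proof. by rewrite /inversions big_set0. Qed.

Lemma inversions0r A : inversions A set0 = 0%N.
Proof. by rewrite /inversions big1 // => i _; rewrite big_set0. Qed.

Lemma extmul1l : left_id (emon set0) extmul.
Proof.
move=> x; rewrite [x]extalgE extmul_sumr; apply: eq_bigr => A _.
rewrite extmulZr extmul_mon /esign inversions0l -setI_eq0 set0I eqxx.
by rewrite set0U scale1r.
Qed.

Lemma extmul1r : right_id (emon set0) extmul.
Proof.
move=> x; rewrite [x]extalgE extmul_suml; apply: eq_bigr => A _.
rewrite extmulZl extmul_mon /esign inversions0r -setI_eq0 setI0 eqxx.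
by rewrite setU0 scale1r.
Qed.

Lemma extmulDl : left_distributive extmul +%R.
Proof. by move=> x y z; exact: (raddfD (extmulr z)). Qed.

Lemma extmulDr : right_distributive extmul +%R.
Proof. by move=> x y z; exact: raddfD. Qed.

Lemma ext1_neq0 : emon set0 != 0.
Proof.
by apply/eqP => /ffunP/(_ set0)/eqP; rewrite !ffunE eqxx oner_eq0.
Qed.

HB.instance Definition _ := GRing.Zmodule_isNzRing.Build E
  extmulA extmul1l extmul1r extmulDl extmulDr ext1_neq0.

Lemma extscaleAl (a : K) (x y : E) : a *: (x * y) = (a *: x) * y.
Proof. by rewrite [RHS]extmulZl. Qed.

Lemma extscaleAr (a : K) (x y : E) : a *: (x * y) = x * (a *: y).
Proof. by rewrite [RHS]extmulZr. Qed.

HB.instance Definition _ := GRing.Lmodule_isLalgebra.Build K E extscaleAl.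
HB.instance Definition _ := GRing.Lalgebra_isAlgebra.Build K E extscaleAr.
HB.instance Definition _ := Algebra_isFalgebra.Build K E.

End ExteriorAlgebra.

Section ExteriorIdeals.
Variables (K : fieldType) (n : nat).
Local Notation E := (extalg K n).
Implicit Types (A B : {set 'I_n}) (J : {vspace E}).

Definition evar (i : 'I_n) : E := emon K [set i].

Definition ecomp (j : int) : {vspace E} :=
  <<[seq emon K A | A in [set A : {set 'I_n} | (#|A| : int) == j]]>>%VS.

Definition eideal (X : seq E) : {vspace E} := ({:E} * <<X>> * {:E})%VS.

Definition face_ideal (Delta : {set {set 'I_n}}) : {vspace E} :=
  eideal [seq emon K F | F in ~: Delta].

(* Homology of (E/J)/(v_0, ..., v_(i-1))(E/J) = E/N in degree j, as cycles
   modulo boundaries, both taken in E_j and containing N :&: E_j. *)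
Definition alpha (v : 'I_n -> E) J (i : 'I_n) (j : int) : nat :=
  let N := (J + eideal [seq v k | k in [set k : 'I_n | (k < i)%N]])%VS in
  let Z := (ecomp j :&: amulr (v i) @^-1: N)%VS in
  let B := (amulr (v i) @: ecomp (j - 1) + N :&: ecomp j)%VS in
  (\dim Z - \dim B)%N.

(* The smallest element of the symmetric difference of A and B lies in A. *)
Definition min_in_left A B : bool :=
  [exists i in A :\: B, [forall k in (A :\: B) :|: (B :\: A), (i <= k)%N]].

(* Refined by the degree so as to be total on monomials; only monomials of the
   same degree matter for graded ideals. *)
Definition rlex_lt A B : bool :=
  (#|A| < #|B|)%N || (#|A| == #|B|) && min_in_left A B.

Definition leads (x : E) A : bool :=
  (x A != 0) && [forall B, (x B != 0) ==> (B == A) || rlex_lt B A].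

Definition initial_ideal J : {vspace E} :=
  eideal [seq emon K A | A in [set A | `[< exists2 x, x \in J & leads x A >]]].

(* f_A for the linear forms f_i = \sum_j a_ij e_j; the empty product is 1. *)
Definition linprod (a : 'M[K]_n) A : E :=
  \prod_(i <- enum A) \sum_j a i j *: evar j.

Definition gl_act (g : 'M[K]_n) : 'End(E) :=
  linfun (fun x : E => \sum_A x A *: linprod g A).

(* The coordinate ring of GL_n is a localization of the ring of polynomials in
   the entries, hence these are all the open subsets. *)
Definition zariski_open_GL (U : set 'M[K]_n) : Prop :=
  exists P : set {mpoly K[n * n]},
    U = [set g | g \in unitmx /\
                 exists2 p, P p & p.@[fun k => mxvec g 0 k] != 0]%classic.

Definition is_gin J G : Prop :=
  exists U, [/\ zariski_open_GL U, (exists g, U g) &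
    forall g, U g -> initial_ideal (gl_act g @: J)%VS = G].

(* On a graded J over an infinite field exactly one G satisfies is_gin J G. *)
Definition gin J : {vspace E} := xget 0%VS [set G | is_gin J G]%classic.

Definition generic_annihilator_number J (i : 'I_n) (j : int) : nat :=
  alpha evar (gin J) i j.

Definition emon_generate J (G : {set {set 'I_n}}) : bool :=
  eideal [seq emon K A | A in G] == J.

(* G(J), for J generated by monomials. *)
Definition emon_gens J : {set {set 'I_n}} :=
  xget set0 [set G | minset (emon_generate J) G]%classic.

Definition emin_is A (l : 'I_n) : bool :=
  (l \in A) && [forall k in A, (l <= k)%N].

Definition count_emon_gens J (d : int) (l : 'I_n) : nat :=
  #|[set A in emon_gens J | ((#|A| : int) == d) && emin_is A l]|.

End ExteriorIdeals.

Definition simplicial_complex n (Delta : {set {set 'I_n}}) : Prop :=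
  (forall F G : {set 'I_n}, F \in Delta -> G \subset F -> G \in Delta) /\
  (forall i : 'I_n, [set i] \in Delta).

Definition alg_indep (K K' : fieldType) (iota : {rmorphism K -> K'}) n
    (a : 'M[K']_n) : Prop :=
  forall p : {mpoly K[n * n]},
    mmap iota (fun k => mxvec a 0 k) p = 0 -> p = 0.

(* Vanishing in K'{Delta} = E'/J' is membership in J', E' being the exterior
   algebra over K'. The maximum of the #|F| is dim Delta + 1. *)
Definition ext_shift (K' : fieldType) n (a : 'M[K']_n)
    (Delta : {set {set 'I_n}}) : {set {set 'I_n}} :=
  \bigcup_(i < (\max_(F in Delta) #|F|).+1)
    [set A : {set 'I_n} | (#|A| == i) &&
      (linprod a A \notin
        (face_ideal K' Delta +
         <<[seq linprod a B | B in
             [set B : {set 'I_n} | (#|B| == i) && min_in_left B A]]>>)%VS)].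

Section PolynomialIdeals.
Variables (K : fieldType) (n : nat).
Local Notation S := {mpoly K[n]}.
Implicit Types I : set S.

Definition pideal (X : set S) : set S :=
  [set p | exists m (c g : 'I_m -> S),
     (forall i, X (g i)) /\ p = \sum_i c i * g i]%classic.

Definition stanley_reisner_ideal (Delta : {set {set 'I_n}}) : set S :=
  pideal [set p | exists2 F : {set 'I_n},
                    F \notin Delta & p = \prod_(i in F) 'X_i]%classic.

Definition pmon_generate I (G : {fset 'X_{1..n}}) : Prop :=
  pideal [set p | exists2 m, m \in G & p = 'X_[m]]%classic = I.

(* G(I), for I generated by monomials. *)
Definition pmon_gens I : {fset 'X_{1..n}} :=
  xget fset0 [set G | pmon_generate I G /\
                forall G', fproper G' G -> ~ pmon_generate I G']%classic.

Definition pmin_is (m : 'X_{1..n}) (l : 'I_n) : bool :=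
  (0 < m l)%N && [forall k, (0 < m k)%N ==> (l <= k)%N].

Definition count_pmon_gens I (d : int) (l : 'I_n) : nat :=
  #|` [fset m in pmon_gens I | ((mdeg m : int) == d) && pmin_is m l]%fset|.

Definition homog_of_deg (d : int) (p : S) : Prop :=
  forall m, m \in msupp p -> (mdeg m : int) = d.

(* A graded free resolution ... -> F_1 -> F_0 -> S/I -> 0 by free modules of
   finite rank, for a graded ideal I. F_i has a basis element in degree
   [frdeg i a] for each a; elements of F_i are row vectors and the differential
   is v |-> v *m frd i; the augmentation F_0 -> S/I is given by a lift to S of
   its values on the basis. *)
Record graded_free_resolution I := GradedFreeResolution {
  frank : nat -> nat;
  frdeg : forall i, 'I_(frank i) -> int;
  frd : forall i, 'M[S]_(frank i.+1, frank i);
  fraug : 'cV[S]_(frank 0);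
  frd_homog : forall i a b,
    homog_of_deg (frdeg a - frdeg b) (frd i a b);
  fraug_homog : forall a, homog_of_deg (frdeg a) (fraug a 0);
  fraug_surj : exists v : 'rV[S]_(frank 0), I (1 - (v *m fraug) 0 0);
  fraug_exact : forall v : 'rV[S]_(frank 0),
    I ((v *m fraug) 0 0) <-> exists w, v = w *m frd 0;
  frd_exact : forall i (v : 'rV[S]_(frank i.+1)),
    v *m frd i = 0 <-> exists w, v = w *m frd i.+1
}.

(* The differentials vanish modulo (x_0, ..., x_(n-1)). *)
Definition minimal_resolution I (F : graded_free_resolution I) : Prop :=
  forall i a b, (frd F i a b)@_0%MM = 0.

(* beta_(i,j)(S/I): the number of basis elements of degree j of F_i in a
   minimal graded free resolution of S/I, which exists and is unique up to
   isomorphism. *)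
Definition graded_betti I (i : nat) (j : int) : nat :=
  xget 0%N [set b | exists2 F : graded_free_resolution I,
      minimal_resolution F &
      b = #|[set a : 'I_(frank F i) | frdeg a == j]%SET|]%classic.

End PolynomialIdeals.

Arguments stanley_reisner_ideal K {n} Delta _.

(* binomial a k = a (a - 1) ... (a - k + 1) / k! for an integer a. *)
Definition binz (a : int) (k : nat) : int :=
  match a with
  | Posz m => 'C(m, k)%:Z
  | Negz m => (-1) ^+ k * 'C(m + k, k)%:Z
  end.

(* Main.v *)
Require Import Defs.
From HB Require Import structures.
From mathcomp Require Import finmap boolp classical_sets cardinality.
From mathcomp Require Import all_boot all_order all_algebra all_field.
From mathcomp Require Import mpoly zify.
Set Implicit Arguments.
Unset Strict Implicit.
Unset Printing Implicit Defensive.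
Import Order.TTheory GRing.Theory Num.Theory.
Local Open Scope ring_scope.

(** Write [Delta_e] for the exterior shifting. For a matrix [h], an element with
    leading monomial [e_A] lies in the image of [J_Delta] under the inverse of
    [h] iff [h_A] is a combination of the lex-smaller [h_B] modulo [J_Delta],
    and this is an equality of ranks of matrices whose entries are polynomials
    in the entries of [h]. The ranks at an algebraically independent matrix are
    attained on a non-empty open subset of [GL_n(K)], whence
    [gin J_Delta = J_(Delta_e)]. Adding row [j] to row [i] of [h] shows that
    [Delta_e] is shifted, so for a set [A] of elements [> l] with [A] in
    [Delta_e] and [l |: A] not in it, [l |: A] is a minimal nonface; these sets
    index a basis of the homology computing [alpha_(l,j)]. Finally, ordered by
    degree and then by decreasing minimum, the minimal nonfaces [u] give linear
    quotients whose colon ideals are generated by the variables [x_k],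
    [k > min u], [k] not in [u]; iterated mapping cones over Koszul complexes
    are minimal for degree reasons and yield the Betti numbers, which do not
    depend on the minimal resolution by the comparison theorem. *)

(** * Monomial subspaces of the exterior algebra *)

(** Minors link the matrix [a] over [K'] with matrices over [K]: a minor that is non-zero at some
    matrix over [K] is a non-zero polynomial, hence non-zero at [a]; and, [K] being infinite,
    finitely many minors that are non-zero at [a] are non-zero together at one invertible matrix
    over [K]. That [e_A] is initial is an equality of two ranks, which need not be an open
    condition. What spreads over an open set is that both ranks take their generic values, and these
    decide the equality. The inverse comes from comparing two actions: [gin] moves the ideal by [g],
    while shifting keeps the ideal and moves the forms, so that the ideal is pulled back. The linear
    quotients start from an empty set that is a face; a complex without it has no vertices, its
    ideal is the whole ring, and it is treated apart. Since vertices are counted from 0, the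
    binomial coefficients contain [l.+1]. *)

Section MonomialSpaces.
Variables (K : fieldType) (n : nat).
Local Notation E := (extalg K n).
Implicit Types (A B C : {set 'I_n}) (P Q : {set {set 'I_n}}) (x y : E).

Lemma emonE A B : emon K A B = (B == A)%:R.
Proof. by rewrite ffunE. Qed.

Lemma extalg_sumE (I : Type) (r : seq I) (p : pred I) (F : I -> E) A :
  (\sum_(i <- r | p i) F i) A = \sum_(i <- r | p i) F i A.
Proof. by elim/big_rec2: _ => [|i y1 y2 _ <-]; rewrite ffunE. Qed.

Lemma extalgZE (c : K) x A : (c *: x) A = c * x A.
Proof. by rewrite ffunE. Qed.

Lemma extalgDE x y A : (x + y) A = x A + y A.
Proof. by rewrite ffunE. Qed.

Lemma extalg0E A : (0 : E) A = 0.
Proof. by rewrite ffunE. Qed.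

Lemma extalg_mulE x y C :
  (x * y) C = \sum_A \sum_B x A * y B * esign K A B * (C == A :|: B)%:R.
Proof.
rewrite {1}/GRing.mul /= /extmul extalg_sumE; apply: eq_bigr => A _.
rewrite extalg_sumE; apply: eq_bigr => B _.
by rewrite extalgZE emonE.
Qed.

Lemma emonM A B : emon K A * emon K B = esign K A B *: emon K (A :|: B).
Proof. exact: extmul_mon. Qed.

(** The ideals, cycles and boundaries behind the annihilator numbers are all of this form, so that
    sums, intersections and dimensions become operations on sets of sets. *)
Definition monspan P : {vspace E} := <<[seq emon K A | A in P]>>%VS.

Lemma mem_monspan P x : x \in monspan P <-> (forall A, A \notin P -> x A = 0).
Proof.
split=> [xP A AP|x0].
  have xP' : x \in <<in_tuple [seq emon K A | A in P]>>%VS by [].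
  rewrite (coord_span xP') extalg_sumE big1 // => i _; rewrite extalgZE.
  have: (in_tuple [seq emon K A | A in P])`_i \in [seq emon K A | A in P].
    exact: mem_nth.
  move=> /mapP[B]; rewrite mem_enum => BP ->.
  rewrite emonE; case: eqP => [AB|_]; last by rewrite mulr0.
  by rewrite AB BP in AP.
rewrite [x]extalgE; apply: memv_suml => A _.
have [AP|/x0->] := boolP (A \in P); last by rewrite scale0r mem0v.
by apply/memvZ/memv_span/map_f; rewrite mem_enum.
Qed.

Lemma emon_monspan P A : (emon K A \in monspan P) = (A \in P).
Proof.
apply/idP/idP => [/mem_monspan h|AP]; last first.
  by apply/memv_span/map_f; rewrite mem_enum.
apply: contraT => /h; rewrite emonE eqxx => /eqP.
by rewrite oner_eq0.
Qed.

Lemma monspan_sub P Q : P \subset Q -> (monspan P <= monspan Q)%VS.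
Proof.
move=> /subsetP PQ; apply/subvP => x /mem_monspan xP; apply/mem_monspan => A AQ.
by apply: xP; apply: contra AQ => /PQ.
Qed.

Lemma monspanD P Q : (monspan P + monspan Q)%VS = monspan (P :|: Q).
Proof.
apply/eqP; rewrite eqEsubv subv_add !monspan_sub ?subsetUl ?subsetUr //=.
apply/span_subvP => x /mapP[A]; rewrite mem_enum inE => /orP[] AP ->.
  by apply: (subvP (addvSl _ _)); rewrite emon_monspan.
by apply: (subvP (addvSr _ _)); rewrite emon_monspan.
Qed.

Lemma monspanI P Q : (monspan P :&: monspan Q)%VS = monspan (P :&: Q).
Proof.
apply/vspaceP => x; rewrite memv_cap; apply/andP/idP.
  move=> [/mem_monspan xP /mem_monspan xQ]; apply/mem_monspan => A.
  by rewrite inE negb_and => /orP[/xP|/xQ].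
by move=> /mem_monspan h; split; apply/mem_monspan => A AP; apply: h;
  rewrite inE negb_and AP ?orbT.
Qed.

Lemma dim_monspan P : \dim (monspan P) = #|P|.
Proof.
have -> : #|P| = size [seq emon K A | A in P] by rewrite size_map cardE.
apply/eqP; rewrite -/(free _).
change (free (in_tuple [seq emon K A | A in P])).
apply/freeP => k k0 i; have lti := ltn_ord i.
have szi : (i < size (enum P))%N by move: (ltn_ord i); rewrite {2}size_map.
have := congr1 (fun x : E => x (nth set0 (enum P) i)) k0.
rewrite /= extalg_sumE extalg0E (bigD1 i) //= big1 ?addr0.
  rewrite extalgZE (nth_map set0) // emonE eqxx mulr1; exact.
move=> j ji; rewrite extalgZE (nth_map set0); last first.
  by move: (ltn_ord j); rewrite {2}size_map.
rewrite emonE nth_uniq ?enum_uniq //; last first.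
  by move: (ltn_ord j); rewrite {2}size_map.
by rewrite eq_sym -[_ == _]/(j == i) (negbTE ji) mulr0.
Qed.

Definition upset P : {set {set 'I_n}} :=
  [set B : {set 'I_n} | [exists A in P, A \subset B]].

Lemma mem_upset P B : reflect (exists2 A, A \in P & A \subset B) (B \in upset P).
Proof. by rewrite inE; exact: (iffP exists_inP). Qed.

Lemma upsetS P A B : A \subset B -> A \in upset P -> B \in upset P.
Proof.
move=> AB /mem_upset[C CP CA]; apply/mem_upset; exists C => //.
exact: subset_trans AB.
Qed.

Lemma sub_upset P : P \subset upset P.
Proof. by apply/subsetP => A AP; apply/mem_upset; exists A. Qed.

Lemma upset_id P : (forall A B, A \in P -> A \subset B -> B \in P) -> upset P = P.
Proof.
move=> h; apply/eqP; rewrite eqEsubset sub_upset andbT.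
by apply/subsetP => B /mem_upset[A AP /(h _ _ AP)].
Qed.

Lemma esign_neq0 A B : (esign K A B != 0) = [disjoint A & B].
Proof. by rewrite /esign; case: ifP => _; rewrite ?signr_eq0 ?eqxx. Qed.

Lemma monspan_upset_mul P x y :
  (x \in monspan (upset P)) || (y \in monspan (upset P)) ->
  x * y \in monspan (upset P).
Proof.
move=> h; apply/mem_monspan => C CP; rewrite extalg_mulE.
rewrite big1 // => A _; rewrite big1 // => B _.
case: eqP => [CE|_]; last by rewrite mulr0.
case/orP: h => /mem_monspan h.
  rewrite h ?mul0r //; apply: contra CP; rewrite CE; exact/upsetS/subsetUl.
rewrite (h B) ?mulr0 ?mul0r //; apply: contra CP; rewrite CE; exact/upsetS/subsetUr.
Qed.

(** Up to sign, [e_B] is [e_A] times [e_(B :\: A)] whenever [A \subset B], and multiplying monomials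
    only enlarges their index sets. *)
Lemma eideal_mon P : eideal [seq emon K A | A in P] = monspan (upset P).
Proof.
apply/eqP; rewrite /eideal eqEsubv; apply/andP; split.
  apply/prodvP => x y xP yP; apply: monspan_upset_mul; apply/orP; left.
  apply: subvP x xP; apply/prodvP => x z _ zP.
  apply: monspan_upset_mul; apply/orP; right.
  exact: (subvP (monspan_sub (sub_upset P))) zP.
apply/span_subvP => x /mapP[B]; rewrite mem_enum => /mem_upset[A AP AB] ->.
have -> : emon K B = (esign K A (B :\: A))^-1 *: (1 * emon K A * emon K (B :\: A)).
  rewrite mul1r emonM scalerA mulVf ?scale1r.
    by congr (emon K _); rewrite -{1}(setID B A) (setIidPr AB).
  by rewrite esign_neq0 -setI_eq0 setIDA setIC setDIl setDv setI0.
apply/memvZ/memv_mul; last exact: memvf.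
apply: memv_mul; first exact: memvf.
by rewrite memv_span // map_f // mem_enum.
Qed.

Definition down_closed (D : {set {set 'I_n}}) : Prop :=
  forall F G : {set 'I_n}, F \in D -> G \subset F -> G \in D.

Lemma face_ideal_monspan D : down_closed D -> face_ideal K D = monspan (~: D).
Proof.
move=> Dd; rewrite /face_ideal eideal_mon upset_id // => A B.
by rewrite !inE => AD AB; apply: contra AD => BD; exact: Dd AB.
Qed.

End MonomialSpaces.

(** * Products of linear forms *)

Section Sorting.
Variable n : nat.
Implicit Types (A B : {set 'I_n}) (i j : 'I_n).

Let ltI : rel 'I_n := fun i j => (i < j)%N.

Lemma sorted_enum_ord A : sorted ltI (enum A).
Proof.
rewrite {1}/enum_mem -enumT; apply: sorted_filter.
  by move=> j i k; exact: ltn_trans.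
by have := iota_ltn_sorted 0 n; rewrite -val_enum_ord sorted_map.
Qed.

Lemma eq_sorted_ord (s t : seq 'I_n) :
  sorted ltI s -> sorted ltI t -> s =i t -> s = t.
Proof.
apply: irr_sorted_eq; first by move=> j i k; exact: ltn_trans.
by move=> i; exact: ltnn.
Qed.

(** Locates [i] in the increasing enumeration of [i |: B]; the length of the segment before it is
    the exponent of the sign in [sprod1M]. *)
Lemma enum_split_ord i B : i \notin B ->
  enum B = [seq j : 'I_n <- enum B | (j < i)%N] ++ [seq j : 'I_n <- enum B | (i < j)%N] /\
  enum (i |: B) =
    [seq j : 'I_n <- enum B | (j < i)%N] ++ i :: [seq j : 'I_n <- enum B | (i < j)%N].
Proof.
move=> iB.
have inF (p : pred 'I_n) j :
  (j \in [seq k : 'I_n <- enum B | p k]) = p j && (j \in B).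
  by rewrite mem_filter mem_enum.
have tr : transitive ltI by move=> j k l; exact: ltn_trans.
have sF (p : pred 'I_n) : sorted ltI [seq j : 'I_n <- enum B | p j].
  by apply: sorted_filter => //; exact: sorted_enum_ord.
have pF (x : 'I_n) (s : seq 'I_n) : sorted ltI s -> all (ltI x) s -> path ltI x s.
  by case: s => //= y s -> /andP[->].
have a1 : all (ltI^~ i) [seq j : 'I_n <- enum B | (j < i)%N] by apply: filter_all.
have a2 : all (ltI i) [seq j : 'I_n <- enum B | (i < j)%N] by apply: filter_all.
have s2 : sorted ltI (i :: [seq j : 'I_n <- enum B | (i < j)%N]) by apply: pF.
have cat_s (s t : seq 'I_n) : sorted ltI s -> sorted ltI t ->
    (forall x y, x \in s -> y \in t -> ltI x y) -> sorted ltI (s ++ t).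
  case: s => // x s /= ss st h; rewrite cat_path ss; apply: pF => //.
  by apply/allP => y yt; apply: h => //; exact: mem_last.
split; apply: eq_sorted_ord; rewrite ?sorted_enum_ord //.
- apply: cat_s => // x y; rewrite !inF => /andP[xi _] /andP[iy _].
  exact: ltn_trans xi iy.
- move=> j; rewrite mem_cat !inF mem_enum -andb_orl.
  case: ltngtP => //= ij.
  by apply/negbTE; move: iB; rewrite (_ : i = j) //; exact/esym/val_inj.
- apply: cat_s => // x y; rewrite inE !inF => /andP[xi _].
  case/predU1P => [->//|/andP[iy _]]; exact: ltn_trans xi iy.
- move=> j; rewrite mem_cat inE !inF mem_enum inE in_set1.
  have [->|ji] := eqVneq j i; first by rewrite orbT.
  rewrite /= -andb_orl; case: ltngtP => //= ij.
  by move: ji; rewrite (_ : i = j) ?eqxx //; exact/esym/val_inj.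
Qed.

End Sorting.

(** * Products of anticommuting elements of square zero *)

Section AnticommutingProducts.
Variables (K : fieldType) (n : nat).
Local Notation E := (extalg K n).
Implicit Types (A B : {set 'I_n}) (i j : 'I_n).
Variable f : 'I_n -> E.
Hypothesis fC : forall i j, f i * f j = - (f j * f i).
Hypothesis f2 : forall i, f i * f i = 0.

Lemma anticomm_prod_move i (s : seq 'I_n) :
  f i * \prod_(j <- s) f j = (-1) ^+ size s *: (\prod_(j <- s) f j * f i).
Proof.
elim: s => [|j s IH] /=; first by rewrite big_nil mulr1 mul1r scale1r.
rewrite big_cons mulrA fC mulNr -!mulrA IH -scalerAr exprS -scalerA.
by rewrite scaleN1r.
Qed.

Lemma anticomm_prod_mem i (s : seq 'I_n) : i \in s -> f i * \prod_(j <- s) f j = 0.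
Proof.
elim: s => // j s IH; rewrite inE big_cons => /predU1P[<-|/IH h].
  by rewrite mulrA f2 mul0r.
by rewrite mulrA fC mulNr -mulrA h mulr0 oppr0.
Qed.

Definition sprod A : E := \prod_(i <- enum A) f i.

Lemma sprod0 : sprod set0 = 1.
Proof. by rewrite /sprod enum_set0 big_nil. Qed.

Lemma inversions1 i B : inversions [set i] B = size [seq j : 'I_n <- enum B | (j < i)%N].
Proof.
rewrite /inversions big_set1 size_filter -big_enum /=.
by elim: (enum B) => [|j s IH]; rewrite ?big_nil // big_cons /= IH.
Qed.

Lemma sprod1M i B : f i * sprod B = esign K [set i] B *: sprod (i |: B).
Proof.
rewrite /esign disjoints1; have [iB|iB] /= := boolP (i \in B).
  by rewrite scale0r anticomm_prod_mem // mem_enum.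
have [e1 e2] := enum_split_ord iB.
rewrite /sprod e2 {1}e1 !big_cat big_cons /= mulrA anticomm_prod_move.
by rewrite -scalerAl mulrA inversions1.
Qed.

Lemma esign_setU1_neq0 i A : i \notin A -> esign K [set i] A != 0.
Proof. by rewrite esign_neq0 disjoints1. Qed.

(** The [f i] satisfy the relations of the generators, so the signs agree with those of monomials:
    peel one factor off [A] and compare signs by [esign_cocycle]. *)
Lemma sprodM A B : sprod A * sprod B = esign K A B *: sprod (A :|: B).
Proof.
elim: {A}#|A| {-2}A (erefl #|A|) => [|k IH] A.
  move/eqP; rewrite cards_eq0 => /eqP->.
  by rewrite sprod0 mul1r set0U /esign inversions0l -setI_eq0 set0I eqxx scale1r.
move=> Ak; have /card_gt0P[i iA] : (0 < #|A|)%N by rewrite Ak.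
have iA' : i \notin A :\ i by rewrite !inE eqxx.
have := IH (A :\ i); rewrite (cardsD1 i) iA in Ak; case: Ak => Ak /(_ Ak) {}IH.
have h := esign_setU1_neq0 iA'.
apply: (scalerI h); rewrite scalerAl.
rewrite -{2}(setD1K iA) -sprod1M -mulrA IH -scalerAr sprod1M !scalerA.
by rewrite setUA setD1K // -esign_cocycle setD1K.
Qed.

End AnticommutingProducts.

(** * Linear forms and the action of matrices on the exterior algebra *)

Section LinearForms.
Variables (K : fieldType) (n : nat).
Local Notation E := (extalg K n).
Implicit Types (A B : {set 'I_n}) (i j : 'I_n) (m g h : 'M[K]_n).

Lemma evarC i j : evar K i * evar K j = - (evar K j * evar K i).
Proof.
rewrite /evar !emonM setUC -scaleNr; congr (_ *: _).
rewrite /esign !disjoints1 !inE eq_sym; case: eqVneq => [_|ij] /=.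
  by rewrite oppr0.
rewrite /inversions !big_set1; case: ltngtP => h; rewrite ?opprK //.
by move: ij; rewrite (val_inj h) eqxx.
Qed.

Lemma evar2 i : evar K i * evar K i = 0.
Proof. by rewrite /evar emonM /esign disjoints1 inE eqxx /= scale0r. Qed.

Definition lform m i : E := \sum_j m i j *: evar K j.

Lemma lformC m i j : lform m i * lform m j = - (lform m j * lform m i).
Proof.
rewrite /lform mulr_suml mulr_sumr -sumrN; apply: eq_bigr => k _.
rewrite mulr_sumr mulr_suml -sumrN; apply: eq_bigr => l _.
rewrite -!scalerAl -!scalerAr evarC !scalerN; congr (- _).
by rewrite !scalerA mulrC.
Qed.

(** Anticommutativity only yields that twice the square is zero; expanding the square also covers
    characteristic 2. *)
Lemma lform2 m i : lform m i * lform m i = 0.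
Proof.
rewrite /lform; elim: (index_enum _) => [|k s IH]; first by rewrite !big_nil mulr0.
rewrite !big_cons mulrDl !mulrDr IH addr0.
rewrite -scalerAl -scalerAr evar2 !scaler0 add0r.
suff -> : m i k *: evar K k * \sum_(j <- s) m i j *: evar K j =
  - (\sum_(j <- s) m i j *: evar K j * (m i k *: evar K k)) by rewrite mulr_suml addNr.
rewrite mulr_sumr -sumrN; apply: eq_bigr => l _.
rewrite -!scalerAl -!scalerAr evarC !scalerN; congr (- _).
by rewrite !scalerA mulrC.
Qed.

Lemma linprodE m A : linprod m A = sprod (lform m) A. Proof. by []. Qed.

Lemma linprodM m A B :
  linprod m A * linprod m B = esign K A B *: linprod m (A :|: B).
Proof. by apply: sprodM; [exact: lformC|exact: lform2]. Qed.

Lemma linprod0 m : linprod m set0 = 1.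
Proof. exact: sprod0. Qed.

Lemma linprod_set1 m i : linprod m [set i] = lform m i.
Proof. by rewrite linprodE /sprod enum_set1 big_seq1. Qed.

Lemma linprodU1 m i A : i \notin A ->
  linprod m (i |: A) = (esign K [set i] A)^-1 *: (lform m i * linprod m A).
Proof.
move=> iA; rewrite -linprod_set1 linprodM scalerA mulVf ?scale1r //.
by rewrite esign_neq0 disjoints1.
Qed.

Lemma emonU1 i A : i \notin A ->
  emon K (i |: A) = (esign K [set i] A)^-1 *: (evar K i * emon K A).
Proof.
move=> iA; rewrite emonM scalerA mulVf ?scale1r //.
by rewrite esign_neq0 disjoints1.
Qed.

Lemma set_ind1 (P : {set 'I_n} -> Prop) : P set0 ->
  (forall i A, i \notin A -> P A -> P (i |: A)) -> forall A, P A.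
Proof.
move=> P0 PU A; elim: {A}#|A| {-2}A (erefl #|A|) => [|k IH] A.
  by move/eqP; rewrite cards_eq0 => /eqP->.
move=> Ak; have /card_gt0P[i iA] : (0 < #|A|)%N by rewrite Ak.
rewrite -(setD1K iA); apply: PU; first by rewrite !inE eqxx.
by apply: IH; move: Ak; rewrite (cardsD1 i) iA => -[].
Qed.

Lemma eq_linprod m g A : (forall i, i \in A -> row i m = row i g) ->
  linprod m A = linprod g A.
Proof.
move=> h; rewrite !linprodE /sprod !big_seq; apply: eq_bigr => i.
rewrite mem_enum => /h /rowP e; apply: eq_bigr => j _.
by have := e j; rewrite !mxE => ->.
Qed.

Lemma lform1 i : lform 1%:M i = evar K i.
Proof.
rewrite /lform (bigD1 i) //= mxE eqxx scale1r big1 ?addr0 // => j ji.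
by rewrite mxE eq_sym (negbTE ji) scale0r.
Qed.

Lemma linprod1mx A : linprod 1%:M A = emon K A.
Proof.
elim/set_ind1: A => [|i A iA IH]; first by rewrite linprod0.
by rewrite linprodU1 // IH lform1 -emonU1.
Qed.

Lemma gl_actE g (x : E) : gl_act g x = \sum_A x A *: linprod g A.
Proof.
have lin : linear (fun x : E => \sum_A x A *: linprod g A).
  move=> a y z; rewrite scaler_sumr -big_split; apply: eq_bigr => A _ /=.
  by rewrite extalgDE extalgZE scalerDl scalerA.
pose L := GRing.isLinear.Build _ _ _ _ _ lin.
pose F : {linear E -> E} := HB.pack (fun x : E => \sum_A x A *: linprod g A) L.
exact: (lfunE F x).
Qed.

Lemma gl_act_emon g A : gl_act g (emon K A) = linprod g A.
Proof.
rewrite gl_actE (bigD1 A) //= emonE eqxx scale1r big1 ?addr0 // => B BA.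
by rewrite emonE (negbTE BA) scale0r.
Qed.

Lemma gl_act1 g : gl_act g 1 = 1.
Proof. by rewrite -[1 in LHS]/(emon K set0) gl_act_emon linprod0. Qed.

(** Products of linear forms multiply with the same signs as monomials, by [linprodM]. *)
Lemma gl_actM g (x y : E) : gl_act g (x * y) = gl_act g x * gl_act g y.
Proof.
rewrite [x]extalgE mulr_suml !linear_sum /= mulr_suml; apply: eq_bigr => A _.
rewrite -scalerAl !linearZ /= -scalerAl; congr (_ *: _).
rewrite [y]extalgE mulr_sumr !linear_sum /= mulr_sumr; apply: eq_bigr => B _.
rewrite -scalerAr !linearZ /= -scalerAr; congr (_ *: _).
by rewrite emonM linearZ /= !gl_act_emon linprodM.
Qed.

Lemma gl_act_evar g i : gl_act g (evar K i) = lform g i.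
Proof. by rewrite /evar gl_act_emon linprod_set1. Qed.

Lemma gl_act_lform g h i : gl_act g (lform h i) = lform (h *m g) i.
Proof.
rewrite {1}/lform linear_sum /=.
under eq_bigr do rewrite linearZ /= gl_act_evar /lform scaler_sumr.
rewrite exchange_big; apply: eq_bigr => k _ /=; rewrite mxE scaler_suml.
by apply: eq_bigr => l _; rewrite scalerA.
Qed.

Lemma gl_act_linprod g h A : gl_act g (linprod h A) = linprod (h *m g) A.
Proof.
elim/set_ind1: A => [|i A iA IH]; first by rewrite !linprod0 gl_act1.
by rewrite !linprodU1 // linearZ /= gl_actM IH gl_act_lform.
Qed.

(** The order is reversed because forms are rows of coefficients, on which [gl_act g] acts by
    multiplication by [g] on the right. *)
Lemma gl_act_comp g h (x : E) : gl_act g (gl_act h x) = gl_act (h *m g) x.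
Proof.
rewrite [x]extalgE !linear_sum; apply: eq_bigr => A _.
by rewrite !linearZ /= !gl_act_emon gl_act_linprod.
Qed.

Lemma gl_act_id (x : E) : gl_act 1%:M x = x.
Proof.
rewrite [RHS]extalgE gl_actE; apply: eq_bigr => A _.
by rewrite linprod1mx.
Qed.

Lemma linprodZ c m A : linprod (c *: m) A = c ^+ #|A| *: linprod m A.
Proof.
elim/set_ind1: A => [|i A iA IH]; first by rewrite !linprod0 cards0 scale1r.
rewrite !linprodU1 // IH cardsU1 iA /= exprS -scalerAr.
have -> : lform (c *: m) i = c *: lform m i.
  by rewrite /lform scaler_sumr; apply: eq_bigr => j _; rewrite mxE scalerA.
rewrite -scalerAl !scalerA; congr (_ *: _).
by rewrite -mulrA mulrC [c * _]mulrC.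
Qed.

End LinearForms.

(** * Coefficients of products of linear forms *)

Section Coefficients.
Variable n : nat.
Implicit Types (F : {set 'I_n}) (i j : 'I_n) (s : seq 'I_n).

(** The minor of [m] on the rows [s] and the columns [F], by Laplace expansion along the first row.
    It is defined over any commutative ring in order to commute with specializing a matrix of
    indeterminates. *)
Fixpoint lincoef (R : comNzRingType) (m : 'M[R]_n) s F : R :=
  if s is i :: s' then
    \sum_(j in F) (-1) ^+ inversions [set j] (F :\ j) * m i j
       * lincoef m s' (F :\ j)
  else (F == set0)%:R.

Lemma map_lincoef (R R' : comNzRingType) (f : {rmorphism R -> R'}) (m : 'M[R]_n) s F :
  lincoef (map_mx f m) s F = f (lincoef m s F).
Proof.
elim: s F => [|i s IH] F /=; first by rewrite rmorph_nat.
rewrite rmorph_sum; apply: eq_bigr => j _.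
by rewrite !rmorphM rmorph_sign mxE IH.
Qed.

Lemma lincoef_card (R : comNzRingType) (m : 'M[R]_n) s F :
  #|F| != size s -> lincoef m s F = 0.
Proof.
elim: s F => [|i s IH] F /=; first by rewrite cards_eq0 => /negbTE->.
move=> Fs; rewrite big1 // => j jF; rewrite IH ?mulr0 //.
by move: Fs; rewrite (cardsD1 j) jF eqSS.
Qed.

Lemma evar_mulE (K : fieldType) (y : extalg K n) j F :
  (evar K j * y) F =
  if j \in F then (-1) ^+ inversions [set j] (F :\ j) * y (F :\ j) else 0.
Proof.
rewrite extalg_mulE (bigD1 [set j]) //= [X in _ + X]big1 ?addr0; last first.
  move=> A Aj; rewrite big1 // => B _; rewrite emonE (negbTE Aj).
  by rewrite !mul0r.
case: ifP => jF; last first.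
  rewrite big1 // => B _; case: eqP => [FE|_]; last by rewrite mulr0.
  by move: jF; rewrite FE !inE eqxx.
rewrite (bigD1 (F :\ j)) //= [X in _ + X]big1 ?addr0.
  rewrite setD1K // eqxx emonE eqxx mul1r mulr1 /esign disjoints1.
  by rewrite !inE eqxx /= mulrC.
move=> B BF; rewrite /esign disjoints1; case: (boolP (j \in B)) => jB /=.
  by rewrite mulr0 mul0r.
case: eqP => [FE|_]; last by rewrite mulr0.
by move: BF; rewrite FE setU1K // eqxx.
Qed.

Lemma linprod_coef (K : fieldType) (m : 'M[K]_n) (A F : {set 'I_n}) :
  (linprod m A : extalg K n) F = lincoef m (enum A) F.
Proof.
rewrite linprodE /sprod; elim: (enum A) F => [|i s IH] F.
  by rewrite big_nil -[1]/(emon K set0) emonE.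
rewrite big_cons mulr_suml extalg_sumE /= [RHS]big_mkcond /=.
apply: eq_bigr => j _; rewrite -scalerAl extalgZE evar_mulE.
by case: ifP; rewrite ?mulr0 // IH mulrA [m i j * _]mulrC.
Qed.

Lemma linprod_card (K : fieldType) (m : 'M[K]_n) (A F : {set 'I_n}) :
  #|F| != #|A| -> (linprod m A : extalg K n) F = 0.
Proof. by move=> h; rewrite linprod_coef lincoef_card // -cardE. Qed.

End Coefficients.

(** * Ranks at generic points *)

Section GenericRank.

Lemma infinite_notin (T : choiceType) (s : seq T) :
  infinite_set [set: T]%classic -> exists x, x \notin s.
Proof.
move=> Tinf; apply: contra_notP Tinf => /forallNP h.
apply: (sub_finite_set _ (finite_seq s)) => x _ /=.
by have := h x; move/negP; rewrite negbK.
Qed.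

Lemma digits_inj n D (f g : 'I_n -> nat) :
  (forall i, f i < D)%N -> (forall i, g i < D)%N ->
  (\sum_i f i * D ^ i = \sum_i g i * D ^ i)%N -> f =1 g.
Proof.
elim: n f g => [|n IH] f g fD gD; first by move=> _ [].
rewrite !big_ord_recl /= !muln1.
have shift (h : 'I_n.+1 -> nat) : (\sum_(i < n) h (lift ord0 i) * D ^ bump 0 i =
    (\sum_(i < n) h (lift ord0 i) * D ^ i) * D)%N.
  by rewrite big_distrl /=; apply: eq_bigr => i _; rewrite -mulnA -expnSr.
rewrite !shift => e.
have D0 : (0 < D)%N by apply: leq_ltn_trans (fD ord0).
have e0 : f ord0 = g ord0.
  have := congr1 (modn^~ D) e.
  by rewrite !(addnC _ (_ * D)) !modnMDl !modn_small.
have {}e : (\sum_(i < n) f (lift ord0 i) * D ^ i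
            = \sum_(i < n) g (lift ord0 i) * D ^ i)%N.
  have := congr1 (divn^~ D) e.
  by rewrite !(addnC _ (_ * D)) !divnMDl // !divn_small // !addn0.
move=> i; case: (unliftP ord0 i) => [j|] ->//.
by apply: (IH (f \o lift ord0) (g \o lift ord0)) => // k /=.
Qed.

(* Kronecker substitution: sending X_i to T^(D^i) keeps the monomials of
   degree less than D distinct. *)
Lemma mpoly_nonroot (K : fieldType) n (p : {mpoly K[n]}) :
  infinite_set [set: K]%classic -> p != 0 -> exists v, p.@[v] != 0.
Proof.
move=> Kinf p0; set D := msize p.
pose e (m : 'X_{1..n}) := (\sum_i m i * D ^ i)%N.
pose q : {poly K} := \sum_(m <- msupp p) p@_m *: 'X^(e m).
have mD m i : m \in msupp p -> (m i < D)%N.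
  move=> /msize_mdeg_lt; apply: leq_ltn_trans.
  by rewrite mdegE (bigD1 i) //= leq_addr.
have [m0 m0p] : exists m, m \in msupp p.
  by exists (mlead p); apply: mlead_supp.
have q0 : q != 0.
  apply/eqP => /(congr1 (fun r : {poly K} => r`_(e m0))).
  rewrite coef0 /q coef_sum (bigD1_seq m0) //= ?msupp_uniq //.
  rewrite coefZ coefXn eqxx mulr1 big1_seq ?addr0 => [/eqP|].
    by rewrite mcoeff_eq0 m0p.
  move=> m /andP[mm0 mp]; rewrite coefZ coefXn; case: eqP => [ee|_]; last first.
    by rewrite mulr0.
  case/eqP: mm0; apply/mnmP; apply: (@digits_inj _ D) => [i|i|]; rewrite ?mD //.
have [zs zsP] : exists zs : seq K, forall t, root q t -> t \in zs.
  have fin : finite_set [set t | root q t]%classic.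
    apply: contrapT => inf.
    have step k : exists s : seq K, [/\ uniq s, size s = k & all (root q) s].
      elim: k => [|k [s [us ss rs]]]; first by exists [::].
      have [t tq ts] : exists2 t, root q t & t \notin s.
        apply: contra_notP inf => h; apply: (sub_finite_set _ (finite_seq s)).
        move=> t /= qt; apply: contrapT => /negP ts; apply: h; by exists t.
      by exists (t :: s); rewrite /= us ts ss rs tq.
    have [s [us ss rs]] := step (size q).
    by have := max_poly_roots q0 rs us; rewrite ss ltnn.
  have [r re] := (finite_seqP _).1 fin; exists r => t qt.
  by have : [set t | root q t]%classic t by []; rewrite re.
have [t /negP ts] := infinite_notin zs Kinf.
exists (fun i => t ^+ (D ^ i)%N); apply: contra_notN ts => /eqP pv; apply: zsP.
rewrite /root /q horner_sum; apply/eqP; rewrite -[RHS]pv mevalE; apply: eq_bigr => m _.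
rewrite hornerZ hornerXn; congr (_ * _); rewrite /e -prodrXr.
by apply: eq_bigr => i _; rewrite -exprM mulnC.
Qed.

Lemma rank_minor (L : fieldType) p q (M : 'M[L]_(p, q)) :
  exists f : 'I_(\rank M) -> 'I_p, exists g : 'I_(\rank M) -> 'I_q,
    \det (mxsub f g M) != 0.
Proof.
pose f := maxrankfun M; pose M1 := rowsub f M.
have r1 : row_full M1^T.
  rewrite /row_full mxrank_tr; exact: maxrowsub_free.
exists f, (fullrankfun r1).
have := fullrowsub_unit r1; rewrite unitmxE unitfE -det_tr.
by congr (\det _ != 0); apply/matrixP => i j; rewrite !mxE.
Qed.

Lemma minor_rank (L : fieldType) p q r (M : 'M[L]_(p, q)) f (g : 'I_r -> 'I_q) :
  \det (mxsub f g M) != 0 -> (r <= \rank M)%N.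
Proof.
rewrite -unitfE -unitmxE => /mxrank_unit <-.
rewrite (_ : mxsub f g M = rowsub f (M *m colsub g 1%:M)).
  apply: leq_trans (mxrankS (rowsub_sub _ _)) _; exact: mxrankM_maxl.
by rewrite mulmx_colsub mulmx1; apply/matrixP => i j; rewrite !mxE.
Qed.

Variables (K : fieldType) (n : nat).
Local Notation P := {mpoly K[n * n]}.

Definition gen_matrix : 'M[P]_n := \matrix_(i, j) 'X_(mxvec_index i j).

(** Specialization of the entries of [gen_matrix] to those of [m], with the variables numbered as in
    [alg_indep], which says that this map has trivial kernel. *)
Definition mxeval (L : fieldType) (f : {rmorphism K -> L}) (m : 'M[L]_n) :=
  mmap f (fun k => mxvec m 0 k).

HB.instance Definition _ (L : fieldType) (f : {rmorphism K -> L}) m :=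
  GRing.RMorphism.copy (@mxeval L f m) (mmap f (fun k => mxvec m 0 k)).

Lemma gen_matrix_eval (L : fieldType) (f : {rmorphism K -> L}) (m : 'M[L]_n) :
  map_mx (mxeval f m) gen_matrix = m.
Proof. by apply/matrixP => i j; rewrite !mxE /mxeval mmapX mmap1U mxvecE. Qed.

Notation mxev := (mxeval idfun).

Lemma det_mxsub_eval (L : fieldType) (f : {rmorphism K -> L}) (m : 'M[L]_n)
    p q r (N : 'M[P]_(p, q)) u (v : 'I_r -> 'I_q) :
  \det (mxsub u v (map_mx (mxeval f m) N)) = mxeval f m (\det (mxsub u v N)).
Proof. by rewrite -det_map_mx map_mxsub. Qed.

(** A minor that is non-zero at [m] is a non-zero polynomial, so algebraic independence keeps it
    non-zero at [a]. *)
Lemma rank_eval_le (L L' : fieldType) (f : {rmorphism K -> L}) (m : 'M[L]_n)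
    (f' : {rmorphism K -> L'}) (a : 'M[L']_n) p q (N : 'M[P]_(p, q)) :
  alg_indep f' a ->
  (\rank (map_mx (mxeval f m) N) <= \rank (map_mx (mxeval f' a) N))%N.
Proof.
move=> ha; have [u [v]] := rank_minor (map_mx (mxeval f m) N).
rewrite det_mxsub_eval => d0; apply: (minor_rank (f := u) (g := v)).
rewrite det_mxsub_eval; apply: contra_neq d0 => /ha ->.
exact: rmorph0.
Qed.

(** Lower semicontinuity of the rank for finitely many matrices at once: [d] is the product over [i]
    of a minor of maximal size among those that are non-zero at [m]. *)
Lemma rank_eval_semicont (I : finType) p q (N : I -> 'M[P]_(p, q)) (m : 'M[K]_n) :
  exists2 d : P, mxev m d != 0 & forall g, mxev g d != 0 -> forall i,
    (\rank (map_mx (mxev m) (N i)) <= \rank (map_mx (mxev g) (N i)))%N.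
Proof.
have h i : exists d : P, mxev m d != 0 /\ forall g, mxev g d != 0 ->
    (\rank (map_mx (mxev m) (N i)) <= \rank (map_mx (mxev g) (N i)))%N.
  have [u [v]] := rank_minor (map_mx (mxev m) (N i)).
  rewrite det_mxsub_eval => d0; exists (\det (mxsub u v (N i))); split=> // g.
  by rewrite -det_mxsub_eval => /minor_rank.
have [d dP] := fin_all_exists h.
exists (\prod_i d i).
  by rewrite rmorph_prod; apply/prodf_neq0 => i _; case: (dP i).
move=> g; rewrite rmorph_prod => /prodf_neq0 g0 i.
by apply: (dP i).2; apply: g0.
Qed.

Hypothesis Kinf : infinite_set [set: K]%classic.

Lemma unit_nonroot (d : P) : d != 0 -> exists2 m, m \in unitmx & mxev m d != 0.
Proof.
move=> d0; have X0 : \det gen_matrix != 0.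
  apply: contra_neq (oner_neq0 K) => X0; have := det_map_mx (mxev 1%:M) gen_matrix.
  by rewrite X0 rmorph0 gen_matrix_eval det1.
have [v] := mpoly_nonroot Kinf (mulf_neq0 d0 X0).
have <- : mxev (vec_mx (\row_k v k)) (d * \det gen_matrix) = (d * \det gen_matrix).@[v].
  by apply: meval_eq => k; rewrite vec_mxK mxE.
rewrite rmorphM /= -det_map_mx gen_matrix_eval mulf_eq0 negb_or => /andP[dv mv].
by exists (vec_mx (\row_k v k)); rewrite // unitmxE unitfE.
Qed.

(** For each [i] a minor witnesses the rank at [a]. The product of these minors is non-zero at some
    invertible [h] over [K], where no rank is thus smaller; [rank_eval_le] excludes larger ones. *)
Lemma rank_eval_generic (L : fieldType) (f : {rmorphism K -> L}) (a : 'M[L]_n)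
    (I : finType) p q (N : I -> 'M[P]_(p, q)) :
  alg_indep f a -> exists2 h, h \in unitmx & forall i,
    \rank (map_mx (mxev h) (N i)) = \rank (map_mx (mxeval f a) (N i)).
Proof.
move=> ha.
have h i : exists d : P, mxeval f a d != 0 /\ forall g, mxev g d != 0 ->
    (\rank (map_mx (mxeval f a) (N i)) <= \rank (map_mx (mxev g) (N i)))%N.
  have [u [v]] := rank_minor (map_mx (mxeval f a) (N i)).
  rewrite det_mxsub_eval => d0; exists (\det (mxsub u v (N i))); split=> // g.
  by rewrite -det_mxsub_eval => /minor_rank.
have [d dP] := fin_all_exists h.
have d0 : \prod_i d i != 0.
  apply/prodf_neq0 => i _; apply: contra_neq (dP i).1 => ->; exact: rmorph0.
have [m mu] := unit_nonroot d0; rewrite rmorph_prod => /prodf_neq0 m0.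
exists m => // i; apply/eqP; rewrite eqn_leq rank_eval_le //=.
by apply: (dP i).2; apply: m0.
Qed.

End GenericRank.

Notation mxev := (mxeval idfun).

(** * Initial monomials and exterior shifting *)

Section Shifting.
Variable n : nat.
Variable D : {set {set 'I_n}}.
Hypothesis Ddown : down_closed D.
Implicit Types (A B C F : {set 'I_n}) (i j k : 'I_n).

Lemma min_in_leftP A B : reflect
  (exists i, [/\ i \in A, i \notin B & forall k, (k < i)%N -> (k \in A) = (k \in B)])
  (min_in_left A B).
Proof.
apply: (iffP exists_inP) => [[i]|[i [iA iB h]]].
  rewrite inE => /andP[iB iA] /forall_inP h; exists i; split=> // k ki.
  apply: contraTeq ki => kAB; rewrite -leqNgt; apply: h; move: kAB.
  by rewrite !inE; case: (k \in A); case: (k \in B).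
exists i; first by rewrite inE iB.
apply/forall_inP => k; apply: contraTT; rewrite -ltnNge => /h.
by rewrite !inE => ->; case: (k \in B).
Qed.

Lemma min_in_left_irr A : min_in_left A A = false.
Proof. by apply/min_in_leftP => -[i [->]]. Qed.

Lemma min_in_left_trans A B C :
  min_in_left A B -> min_in_left B C -> min_in_left A C.
Proof.
move=> /min_in_leftP[p [pA pB hp]] /min_in_leftP[q [qB qC hq]].
apply/min_in_leftP; case: (ltngtP p q) => [pq|qp|/val_inj pq]; last first.
- by rewrite pq qB in pB.
- exists q; split=> [|//|k kq]; first by rewrite hp.
  by rewrite hp ?hq // (ltn_trans kq).
- exists p; split=> [//||k kp]; first by rewrite -hq.
  by rewrite hp ?hq // (ltn_trans kp).
Qed.

(* [A] is the initial monomial of an element of the preimage of the face ideal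
   under [gl_act h]. *)
Definition initial_at (L : fieldType) (h : 'M[L]_n) A : Prop :=
  exists x : extalg L n,
    [/\ x A != 0,
        forall B, x B != 0 -> #|B| = #|A| /\ (B == A) || min_in_left B A &
        forall F, F \in D -> (gl_act h x) F = 0].

Lemma face_idealP (L : fieldType) (x : extalg L n) :
  x \in face_ideal L D <-> (forall F, F \in D -> x F = 0).
Proof.
rewrite face_ideal_monspan //; split=> [/mem_monspan h F FD|h].
  by apply: h; rewrite inE FD.
by apply/mem_monspan => F; rewrite inE negbK; exact: h.
Qed.

Lemma face_ideal_mul (L : fieldType) (x y : extalg L n) :
  (x \in face_ideal L D) || (y \in face_ideal L D) -> x * y \in face_ideal L D.
Proof.
have -> : face_ideal L D = monspan L (upset (~: D)) by rewrite -eideal_mon.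
exact: monspan_upset_mul.
Qed.

Lemma gl_act_coef (L : fieldType) (h : 'M[L]_n) (x : extalg L n) F :
  (gl_act h x) F = \sum_B x B * lincoef h (enum B) F.
Proof.
rewrite gl_actE extalg_sumE; apply: eq_bigr => B _.
by rewrite extalgZE linprod_coef.
Qed.

(** All monomials of the witness have degree [#|A|], so its image is only multiplied by
    [c ^+ #|A|]. *)
Lemma initial_atZ (L : fieldType) (h : 'M[L]_n) (c : L) A :
  c != 0 -> initial_at h A -> initial_at (c *: h) A.
Proof.
move=> c0 [x [xA lt h0]]; exists x; split=> // F FD.
suff -> : gl_act (c *: h) x = c ^+ #|A| *: gl_act h x.
  by rewrite extalgZE h0 ?mulr0.
rewrite !gl_actE scaler_sumr; apply: eq_bigr => B _.
have [->|/lt[BA _]] := eqVneq (x B) 0; first by rewrite !scale0r scaler0.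
by rewrite linprodZ BA !scalerA mulrC.
Qed.

(** The witness is [e_A] itself: its image is homogeneous of degree [#|A|], where the face ideal is
    everything. *)
Lemma initial_at_card (L : fieldType) (h : 'M[L]_n) A :
  (forall F, F \in D -> #|F| != #|A|) -> initial_at h A.
Proof.
move=> hA; exists (emon L A); split=> [|B|F FD].
- by rewrite emonE eqxx oner_neq0.
- by rewrite emonE; have [->|_] := eqVneq B A; rewrite ?eqxx.
- by rewrite gl_act_emon linprod_card ?hA.
Qed.

Lemma ext_shiftP (L : fieldType) (h : 'M[L]_n) A :
  A \notin ext_shift h D <-> initial_at h A.
Proof.
pose S := [set B : {set 'I_n} | (#|B| == #|A|) && min_in_left B A].
have spanE : <<[seq linprod h B | B in S]>>%VS = (gl_act h @: monspan L S)%VS.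
  rewrite /monspan limg_span -map_comp; congr (<<_>>)%VS.
  by apply: eq_map => B /=; rewrite gl_act_emon.
have AS : A \notin S by rewrite inE min_in_left_irr andbF.
have depE : linprod h A \in (face_ideal L D + <<[seq linprod h B | B in S]>>)%VS
    <-> initial_at h A.
  rewrite spanE; split.
    move=> /memv_addP[u uJ [v /memv_imgP[y yS ->] e]].
    move/mem_monspan: yS => yS; exists (emon L A - y); split.
    - by rewrite extalgDE emonE eqxx !ffunE yS // subr0 oner_neq0.
    - move=> B; rewrite extalgDE emonE !ffunE; have [->|_] := eqVneq B A; first by [].
      rewrite sub0r oppr_eq0 => yB; have : B \in S by apply: contraR yB => /yS->.
      by rewrite inE => /andP[/eqP-> ->].
    - move=> F FD; rewrite linearB /= gl_act_emon e addrK.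
      by move/face_idealP: uJ => ->.
  move=> [x [xA lt h0]].
  have -> : linprod h A = (x A)^-1 *: gl_act h x + gl_act h (emon L A - (x A)^-1 *: x).
    by rewrite linearB linearZ /= gl_act_emon addrC subrK.
  apply: memv_add; first by apply: memvZ; apply/face_idealP.
  apply: memv_img; apply/mem_monspan => B.
  rewrite inE extalgDE !ffunE /= -[_ *: _]/(_ * _); have [->|BA] := eqVneq B A.
    by rewrite mulVf ?subrr.
  have [->|/lt[-> ]] := eqVneq (x B) 0; first by rewrite mulr0 subr0.
  by rewrite (negbTE BA) eqxx /= => ->.
(* The union defining [ext_shift] stops at the largest size of a face; beyond it every [A] is
   initial by [initial_at_card]. *)
have [le|gt] := leqP #|A| (\max_(F in D) #|F|); last first.
  have dA : initial_at h A.
    apply: initial_at_card => F FD; apply: contraTneq gt => <-.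
    by rewrite -leqNgt; exact: (leq_bigmax_cond (P := mem D)).
  split=> // _.
  apply/bigcupP => -[i _]; rewrite inE => /andP[/eqP iA].
  rewrite -iA; move/depE: dA => /[swap] /negP; exact.
split=> [|dA].
  apply: contraNP => dA; apply/bigcupP;
    exists (Ordinal (n := (\max_(F in D) #|F|).+1) le) => //.
  by rewrite inE eqxx /=; apply/negP => /depE.
apply/bigcupP => -[i _]; rewrite inE => /andP[/eqP iA]; rewrite -iA.
by move/depE: dA => ->.
Qed.

Lemma setDUK B C : B \subset C -> C :\: B :|: B = C.
Proof. by move=> BC; rewrite setUC -{1}(setIidPr BC) setID. Qed.

Lemma emon_mulE (L : fieldType) (x : extalg L n) B C :
  (x * emon L B) C = if B \subset C then x (C :\: B) * esign L (C :\: B) B else 0.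
Proof.
rewrite extalg_mulE exchange_big (bigD1 B) //= [X in _ + X]big1 ?addr0; last first.
  move=> B' BB'; rewrite big1 // => A _.
  by rewrite emonE (negbTE BB') mulr0 !mul0r.
case: ifPn => BC; last first.
  rewrite big1 // => A _; case: eqP => [CE|_]; last by rewrite mulr0.
  by move: BC; rewrite CE subsetUr.
rewrite (bigD1 (C :\: B)) //= [X in _ + X]big1 ?addr0.
  by rewrite emonE eqxx setDUK // eqxx !mulr1.
move=> A AC; rewrite emonE eqxx mulr1; case: eqP => [CE|_]; last by rewrite mulr0.
have [dAB|] := boolP [disjoint A & B]; last first.
  by rewrite -(esign_neq0 L) negbK => /eqP->; rewrite mulr0 mul0r.
move: AC; rewrite CE setDUl setDv setU0 => /eqP[].
by symmetry; apply/setDidPl.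
Qed.

(** Multiply the witness by [e_(B :\: A)]: the terms meeting [B :\: A] vanish, and adding the same
    disjoint set to the other index sets preserves their order. *)
Lemma initial_at_up (L : fieldType) (h : 'M[L]_n) A B :
  A \subset B -> initial_at h A -> initial_at h B.
Proof.
move=> AB [x [xA lt h0]]; have BDA : B :\: (B :\: A) = A.
  by rewrite setDDr setDv set0U; apply/setIidPr.
exists (x * emon L (B :\: A)); split.
- rewrite emon_mulE subsetDl mulf_neq0 // BDA // esign_neq0 -setI_eq0.
  by rewrite setIDA setIC setDIl setDv setI0.
- move=> C; rewrite emon_mulE; case: ifP => [BC|]; last by rewrite eqxx.
  rewrite mulf_eq0 negb_or => /andP[/lt[cC lC] _].
  have CE : C = (C :\: (B :\: A)) :|: (B :\: A).
    by rewrite setDUK.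
  have cE (X : {set 'I_n}) : X \subset C -> #|C| = (#|C :\: X| + #|X|)%N.
    by move=> XC; rewrite cardsD (setIidPr XC) subnK // subset_leq_card.
  split; first by rewrite (cE _ BC) cC cardsD (setIidPr AB) addnC subnK // subset_leq_card.
  case/orP: lC => [/eqP CA|/min_in_leftP[i [iC iA hi]]].
    by rewrite CE CA setUC setDUK // eqxx.
  apply/orP; right.
  apply/min_in_leftP; exists i.
  move: iC; rewrite !inE => /andP[+ iC]; rewrite negb_and negbK (negbTE iA) /= => iB.
  split=> // k /hi; move/subsetP: BC => /(_ k); move/subsetP: AB => /(_ k).
  rewrite !inE; case: (k \in A); case: (k \in B); case: (k \in C) => //= h1 h2;
    by [have := h1 isT|have := h2 isT].
- apply/face_idealP; rewrite gl_actM; apply: face_ideal_mul.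
  by apply/orP; left; apply/face_idealP.
Qed.

(* Adding row [j] to row [i] of [h] turns the leading monomial [e_A] into
   [e_A + e_(A - i + j)], up to signs. *)
Definition addrow i j (L : fieldType) : 'M[L]_n := 1%:M + delta_mx i j.

Lemma addrow_emon (L : fieldType) i j A : i != j ->
  gl_act (addrow i j L) (emon L A) =
  emon L A + (if (i \in A) && (j \notin A) then
    (esign L [set i] (A :\ i))^-1 * esign L [set j] (A :\ i) else 0)
      *: emon L (j |: A :\ i).
Proof.
move=> ij; have row_id k : k != i -> row k (addrow i j L) = row k 1%:M.
  move=> ki; apply/rowP => l; rewrite !mxE [k == i](negbTE ki) /= addr0.
  by [].
rewrite gl_act_emon; have [iA|iA] /= := boolP (i \in A); last first.
  rewrite scale0r addr0 -[RHS]linprod1mx; apply: eq_linprod => k kA.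
  by apply: row_id; apply: contraNneq iA => <-.
have iA' : i \notin A :\ i by rewrite !inE eqxx.
rewrite -{1}(setD1K iA) linprodU1 //.
have -> : linprod (addrow i j L) (A :\ i) = emon L (A :\ i).
  rewrite -[RHS]linprod1mx; apply: eq_linprod => k kA.
  by apply: row_id; move: kA; rewrite !inE => /andP[].
have -> : lform (addrow i j L) i = evar L i + evar L j.
  rewrite /lform (bigD1 i) //= (bigD1 j) 1?eq_sym //= !mxE !eqxx /=.
  rewrite (negbTE ij) addr0 add0r !scale1r big1 ?addr0 //.
  move=> k /andP[ki kj]; rewrite !mxE eqxx (eq_sym i k) (negbTE ki) (negbTE kj).
  by rewrite addr0 scale0r.
rewrite mulrDl scalerDr -emonU1 // setD1K //; congr (_ + _).
rewrite /evar emonM scalerA; congr (_ *: _).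
case: ifP => // /negbFE jA; rewrite /esign !disjoints1 !inE jA eq_sym ij /=.
by rewrite mulr0.
Qed.

(** The row operation sends [x] to an element [y] with leading monomial [e_B]. Indeed [e_B] does not
    occur in [x], since [A] precedes [B], and replacing [i] by [j] preserves the strict order, so
    that only [e_A] contributes to [e_B] and all other terms precede it. *)
Lemma initial_at_exchange (L : fieldType) (h : 'M[L]_n) A i j :
  i \in A -> j \notin A -> (i < j)%N ->
  initial_at (addrow i j L *m h) A -> initial_at h (j |: A :\ i).
Proof.
move=> iA jA lij [x [xA lt h0]]; set B := j |: A :\ i.
have ij : i != j by apply: contraTneq lij => ->; rewrite ltnn.
pose s C : L := if (i \in C) && (j \notin C) then
    (esign L [set i] (C :\ i))^-1 * esign L [set j] (C :\ i) else 0.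
have s0 C : s C != 0 -> (i \in C) && (j \notin C).
  by rewrite /s; case: ifP; rewrite ?eqxx.
have cU C : (i \in C) && (j \notin C) -> #|j |: C :\ i| = #|C|.
  by move=> /andP[iC jC]; rewrite cardsU1 !inE (negbTE jC) andbF (cardsD1 i C) iC.
have AB : min_in_left A B.
  apply/min_in_leftP; exists i; split=> // [|k ki].
    by rewrite !inE (negbTE ij) eqxx.
  have kij : (k != i) && (k != j).
    apply/andP; split; apply: contraTneq ki => ->; rewrite ?ltnn //.
    by rewrite -leqNgt ltnW.
  by move: kij; rewrite !inE => /andP[-> /negbTE->].
pose y := gl_act (addrow i j L) x.
have yE C : y C = x C + \sum_(C' | j |: C' :\ i == C) x C' * s C'.
  rewrite /y [x]extalgE linear_sum extalg_sumE.
  under eq_bigr do rewrite linearZ /= addrow_emon // scalerDr extalgDE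
    !extalgZE -/(s _).
  rewrite big_split /= -extalgE; congr (_ + _).
    rewrite {2}[x]extalgE extalg_sumE; by under [RHS]eq_bigr do rewrite extalgZE.
  rewrite [RHS]big_mkcond; apply: eq_bigr => C' _ /=; rewrite emonE eq_sym.
  by case: eqP => _; rewrite !(mulr0, mulr1).
have ltS C : x C != 0 -> s C != 0 -> C != A -> min_in_left (j |: C :\ i) B.
  move=> /lt[_] + /s0/andP[iC jC] CA; rewrite (negbTE CA) => /min_in_leftP[k [kC kA hk]].
  have ki : k != i by apply: contraNneq kA => ->.
  have kj : k != j by apply: contraTneq kC => ->.
  apply/min_in_leftP; exists k; split; first by rewrite !inE kC ki orbT.
    by rewrite !inE (negbTE kj) (negbTE kA) andbF.
  by move=> l /hk; rewrite !inE => ->.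
have xB : x B = 0.
  apply: contraTeq isT => /lt[_ /orP[/eqP e|]].
    by move: jA; rewrite -e !inE eqxx.
  by move=> /(min_in_left_trans AB); rewrite min_in_left_irr.
exists y; split.
- rewrite yE xB add0r (bigD1 A) //= [X in _ + X]big1 ?addr0.
    apply: mulf_neq0 => //; rewrite /s iA jA /= mulf_neq0 // ?invr_eq0.
      by rewrite esign_neq0 disjoints1 !inE eqxx.
    by rewrite esign_neq0 disjoints1 !inE (negbTE jA) andbF.
  move=> C /andP[/eqP CB CA]; apply/eqP/negPn/negP.
  rewrite mulf_eq0 negb_or => /andP[xC sC].
  by have := ltS C xC sC CA; rewrite CB min_in_left_irr.
- move=> C; rewrite yE => yC.
  have [xC|xC] := eqVneq (x C) 0; last first.
    have [cC lC] := lt _ xC; split; first by rewrite cC cU // iA jA.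
    apply/orP; right; case/orP: lC => [/eqP->//|CA].
    exact: min_in_left_trans CA AB.
  have [C' /andP[/eqP<- ]] : exists C', (j |: C' :\ i == C) && (x C' * s C' != 0).
    apply/existsP; apply: contraNT yC; rewrite negb_exists => /forallP h1.
    rewrite xC add0r big1 // => C' e; apply/eqP/negPn.
    by have := h1 C'; rewrite e.
  rewrite mulf_eq0 negb_or => /andP[xC' sC'].
  have [->|C'A] := eqVneq C' A; first by rewrite eqxx.
  split; last by rewrite ltS ?orbT.
  by rewrite !cU ?iA ?jA ?(s0 _ sC') //; case: (lt _ xC').
- by move=> F FD; rewrite gl_act_comp h0.
Qed.

End Shifting.

(** * The generic initial ideal of a face ideal *)

Section GenericInitialIdeal.
Variable n : nat.
Variable D : {set {set 'I_n}}.
Hypothesis Ddown : down_closed D.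
Implicit Types (A B C F : {set 'I_n}) (i j k : 'I_n).

Local Notation N := #|{: {set 'I_n}}|.

(** Rows are the [f_B] modulo the face ideal, for [B] before [A], and for [A] itself unless
    [strict]. Zero rows and columns give all these matrices the same size, as one finite family of
    polynomial matrices requires. *)
Definition lexmx (R : comNzRingType) (m : 'M[R]_n) (A : {set 'I_n}) (strict : bool) :
    'M[R]_N :=
  \matrix_(r < N, c < N)
    let B : {set 'I_n} := enum_val r in
    let F : {set 'I_n} := enum_val c in
    if [&& #|B| == #|A|, min_in_left B A || ~~ strict && (B == A) & F \in D]
    then lincoef m (enum B) F else 0.

Lemma map_lexmx (R R' : comNzRingType) (f : {rmorphism R -> R'}) (m : 'M[R]_n) A s :
  map_mx f (lexmx m A s) = lexmx (map_mx f m) A s.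
Proof.
apply/matrixP => r c; rewrite !mxE /=; case: ifP => _; last by rewrite rmorph0.
by rewrite map_lincoef.
Qed.

Lemma initial_at_lexmx (L : fieldType) (h : 'M[L]_n) A :
  initial_at D h A <-> \rank (lexmx h A true) = \rank (lexmx h A false).
Proof.
set M0 := lexmx h A true; set M1 := lexmx h A false.
have rowE r : row r M0 = if enum_val r == A then 0 else row r M1.
  apply/rowP => c; have [rA|rA] := eqVneq (enum_val r) A; rewrite !mxE /=.
    by rewrite rA min_in_left_irr /= andbF.
  by rewrite (negbTE rA).
have M01 : (M0 <= M1)%MS.
  apply/row_subP => r; rewrite rowE; case: ifP => _; first exact: sub0mx.
  exact: row_sub.
have -> : (\rank M0 = \rank M1) <-> (row (enum_rank A) M1 <= M0)%MS.
  have := mxrank_leqif_sup M01 => -[_ e]; split=> [/eqP|h1].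
    by rewrite e => /row_subP.
  apply/eqP; rewrite e; apply/row_subP => r.
  have [rA|rA] := eqVneq (enum_val r) A; first by rewrite -[r]enum_valK rA.
  by have := row_sub r M0; rewrite rowE (negbTE rA).
have M0E r F : F \in D -> M0 r (enum_rank F) =
    if (#|enum_val r| == #|A|) && min_in_left (enum_val r) A
    then lincoef h (enum (enum_val r)) F else 0.
  by move=> FD; rewrite mxE /= enum_rankK FD orbF andbT.
have lexmx0 r F b : F \notin D -> lexmx h A b r (enum_rank F) = 0.
  by move=> FD; rewrite mxE /= enum_rankK (negbTE FD) !andbF.
have M1A F : F \in D -> M1 (enum_rank A) (enum_rank F) = lincoef h (enum A) F.
  by move=> FD; rewrite mxE /= !enum_rankK FD !eqxx orbT.
split.
  move=> [x [xA lt h0]]; apply/submxP.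
  exists (\row_r (- (x A)^-1 * (if enum_val r == A then 0 else x (enum_val r)))).
  apply/rowP => c; rewrite -[c]enum_valK; move: (enum_val c : {set 'I_n}) => F {c}.
  rewrite [LHS]mxE [RHS]mxE.
  have [FD|FD] := boolP (F \in D); last first.
    by rewrite lexmx0 // big1 // => r _; rewrite lexmx0 ?mulr0.
  rewrite M1A //; have := h0 _ FD; rewrite gl_act_coef.
  rewrite (bigD1 A) //= => /eqP; rewrite addr_eq0 => /eqP e.
  rewrite (reindex_onto (@enum_rank _) (@enum_val _ _)) /=; last first.
    by move=> r _; exact: enum_valK.
  apply: (mulfI xA); rewrite e mulr_sumr -sumrN.
  rewrite big_mkcond /= [RHS]big_mkcond /=; apply: eq_bigr => B _.
  rewrite mxE enum_rankK eqxx M0E // enum_rankK.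
  have [->|BA] := eqVneq B A; first by rewrite mulr0 mul0r mulr0.
  have [->|/lt[-> ]] := eqVneq (x B) 0; first by rewrite !(mul0r, mulr0) oppr0.
  rewrite (negbTE BA) eqxx /= => ->; rewrite !mulNr mulrN !mulrA mulfV ?mul1r //.
move=> /submxP[d dE].
pose x : extalg L n := emon L A - \sum_(B : {set 'I_n}) (if (#|B| == #|A|) && min_in_left B A
  then d 0 (enum_rank B) else 0) *: emon L B.
have xE (B : {set 'I_n}) : x B = (B == A)%:R - (if (#|B| == #|A|) && min_in_left B A
  then d 0 (enum_rank B) else 0).
  rewrite !ffunE extalg_sumE; congr (_ - _).
  rewrite (bigD1 B) //= extalgZE emonE eqxx mulr1 big1 ?addr0 // => C CB.
  by rewrite extalgZE emonE (eq_sym B) (negbTE CB) mulr0.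
exists x; split.
- by rewrite xE eqxx min_in_left_irr andbF subr0 oner_neq0.
- move=> B; rewrite xE; have [->|BA] := eqVneq B A; first by [].
  by case: ifP => [/andP[/eqP-> ->]//|]; rewrite subr0 eqxx.
- move=> F FD; rewrite gl_act_coef.
  have := congr1 (fun v : 'rV_ _ => v 0 (enum_rank F)) dE.
  rewrite [LHS]mxE [RHS]mxE M1A // => e.
  under eq_bigr do rewrite xE mulrBl.
  rewrite sumrB; apply/eqP; rewrite subr_eq0; apply/eqP.
  transitivity (lincoef h (enum A) F).
    rewrite (bigD1 A) //= eqxx mul1r big1 ?addr0 // => B BA.
    by rewrite (negbTE BA) mul0r.
  rewrite e.
  rewrite (reindex_onto (@enum_rank _) (@enum_val _ _)) /=; last first.
    by move=> r _; exact: enum_valK.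
  rewrite big_mkcond /=; apply: eq_bigr => B _.
  rewrite enum_rankK eqxx M0E // enum_rankK.
  by case: ifP; rewrite ?mulr0 ?mul0r.
Qed.

(** The image of the ideal under [g] is its preimage under [invmx g], which is the form required by
    [initial_at]. *)
Lemma initial_ideal_gl_act (L : fieldType) (g : 'M[L]_n) :
  g \in unitmx ->
  initial_ideal (gl_act g @: face_ideal L D)%VS =
  face_ideal L [set A | ~~ `[< initial_at D (invmx g) A >]].
Proof.
move=> gu; rewrite /initial_ideal /face_ideal.
suff -> : [set A | `[< exists2 x, x \in (gl_act g @: face_ideal L D)%VS & leads x A >]]
    = ~: [set A | ~~ `[< initial_at D (invmx g) A >]] by [].
apply/setP => A; rewrite !inE negbK; apply/asboolP/asboolP.
  move=> [x /memv_imgP[z zJ xE] /andP[xA /forall_inP lt]].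
  (* An element of the ideal may be inhomogeneous; its component of degree [#|A|] has the same
     leading monomial and stays in the ideal, which is graded. *)
  pose y : extalg L n := [ffun B : {set 'I_n} => if #|B| == #|A| then x B else 0].
  exists y; split; first by rewrite ffunE eqxx.
    move=> B; rewrite ffunE; case: ifP; rewrite ?eqxx // => BA /lt.
    rewrite /rlex_lt (eqP BA) ltnn eqxx /=; by [].
  move=> F FD; rewrite gl_act_coef; have [FA|FA] := eqVneq #|F| #|A|.
    transitivity ((gl_act (invmx g) x) F).
      rewrite gl_act_coef; apply: eq_bigr => B _; rewrite ffunE.
      case: ifPn => // BA; rewrite mul0r lincoef_card ?mulr0 //.
      by rewrite -cardE FA eq_sym.
    by rewrite xE gl_act_comp mulmxV // gl_act_id; apply: (face_idealP Ddown _).1.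
  rewrite big1 // => B _; rewrite ffunE; case: ifP => [/eqP BA|_]; rewrite ?mul0r //.
  by rewrite lincoef_card ?mulr0 // -cardE BA.
move=> [x [xA lt h0]]; exists x.
  apply/memv_imgP; exists (gl_act (invmx g) x); first exact/(face_idealP Ddown).
  by rewrite gl_act_comp mulVmx // gl_act_id.
rewrite /leads xA /=; apply/forall_inP => B /lt[BA].
by rewrite /rlex_lt BA ltnn eqxx.
Qed.

Variable K : fieldType.
Hypothesis Kinf : infinite_set [set: K]%classic.

(** Two non-empty open subsets of the general linear group meet: over an infinite field the product
    of two non-zero polynomials is non-zero at some invertible matrix. *)
Lemma is_gin_uniq (J G G' : {vspace extalg K n}) :
  is_gin J G -> is_gin J G' -> G' = G.
Proof.
move=> [U [[P UE] [g Ug] UG]] [U' [[P' UE'] [g' Ug'] UG']].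
move: (Ug) (Ug'); rewrite UE UE' => -[_ [p Pp p0]] [_ [p' Pp' p'0]].
have pp0 : p * p' != 0.
  by apply: mulf_neq0; [apply: contra_neq p0|apply: contra_neq p'0] => ->;
    rewrite meval0.
have [m mu] := unit_nonroot Kinf pp0.
rewrite rmorphM mulf_eq0 negb_or => /andP[mp mp'].
rewrite -(UG m) ?UE; last by split=> //; exists p.
by rewrite -(UG' m) // UE'; split=> //; exists p'.
Qed.

Variables (K' : fieldType) (iota : {rmorphism K -> K'}) (a : 'M[K']_n).
Hypothesis ha : alg_indep iota a.

Let T := ({set 'I_n} * bool)%type.

Let initial_at_rank (h : 'M[K]_n) :
  (forall As : T, \rank (lexmx h As.1 As.2) = \rank (lexmx a As.1 As.2)) ->
  forall A, A \notin ext_shift a D <-> initial_at D h A.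
Proof.
move=> e A; rewrite ext_shiftP // !initial_at_lexmx.
by rewrite (e (A, true)) (e (A, false)).
Qed.

Let lexmx_eval (L : fieldType) (f : {rmorphism K -> L}) (m : 'M[L]_n)
    (N : 'M[{mpoly K[n * n]}]_n) A s :
  map_mx (mxeval f m) (lexmx N A s) = lexmx (map_mx (mxeval f m) N) A s.
Proof. exact: map_lexmx. Qed.

Lemma exists_generic : exists2 h : 'M[K]_n, h \in unitmx &
  forall As : T, \rank (lexmx h As.1 As.2) = \rank (lexmx a As.1 As.2).
Proof.
have [h hu hr] := rank_eval_generic Kinf (fun As : T => lexmx (gen_matrix K n) As.1 As.2) ha.
by exists h => // As; have := hr As; rewrite !lexmx_eval !gen_matrix_eval.
Qed.

Lemma rank_lexmx_le (h : 'M[K]_n) A s : (\rank (lexmx h A s) <= \rank (lexmx a A s))%N.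
Proof.
have := rank_eval_le (idfun : {rmorphism K -> K}) h (lexmx (gen_matrix K n) A s) ha.
by rewrite !lexmx_eval !gen_matrix_eval.
Qed.

Lemma lexmxZ (L : fieldType) (c : L) (h : 'M[L]_n) A s :
  lexmx (c *: h) A s = c ^+ #|A| *: lexmx h A s.
Proof.
apply/matrixP => i j; rewrite !mxE /=;
case: ifP => [/andP[/eqP <- _]|_]; last by rewrite mulr0.
by rewrite -!linprod_coef linprodZ extalgZE.
Qed.

(* The adjugate is polynomial in the entries and differs from the inverse by a
   non-zero scalar, which does not change initial monomials. *)
Lemma gin_face_ideal : gin (face_ideal K D) = face_ideal K (ext_shift a D).
Proof.
have [h hu hr] := exists_generic.
suff G : is_gin (face_ideal K D) (face_ideal K (ext_shift a D)).
  by apply: xget_unique => // G' /(is_gin_uniq G).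
pose g0 := invmx h.
have hdet : \det h != 0 by rewrite -unitfE -unitmxE.
have adjE (g : 'M[K]_n) : g \in unitmx -> \adj g = \det g *: invmx g.
  move=> gu; rewrite /invmx gu scalerA mulfV ?scale1r //.
  by rewrite -unitfE -unitmxE.
have adj_eval (g : 'M[K]_n) As : map_mx (mxev g) (lexmx (\adj (gen_matrix K n)) As.1 As.2)
    = lexmx (\adj g) As.1 As.2.
  by rewrite lexmx_eval map_mx_adj gen_matrix_eval.
(* At [g0] the adjugate is a non-zero multiple of [h], so the ranks are generic there. Where [p]
   does not vanish they are at least as large, hence generic by [rank_lexmx_le]. *)
have [p p0 pP] := rank_eval_semicont
  (fun As : T => lexmx (\adj (gen_matrix K n)) As.1 As.2) g0.
exists [set g : 'M[K]_n | g \in unitmx /\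
  exists2 q : {mpoly K[n * n]}, [set p]%classic q & mxev g q != 0]%classic.
split; first by exists [set p]%classic.
  by exists g0; split; [rewrite unitmx_inv|exists p].
move=> g [gu [_ -> gp]]; rewrite initial_ideal_gl_act //; congr face_ideal.
have gdet : \det g != 0 by rewrite -unitfE -unitmxE.
apply/setP => A; rewrite inE -[RHS]negbK; congr (~~ _).
have rk (As : T) : \rank (lexmx (\adj g) As.1 As.2) = \rank (lexmx a As.1 As.2).
  apply/eqP; rewrite eqn_leq rank_lexmx_le /=.
  have := pP g gp As; rewrite !adj_eval adjE ?unitmx_inv // /g0 invmxK lexmxZ -hr.
  by rewrite mxrank_scale_nz // expf_neq0 // det_inv invr_eq0.
have gE : initial_at D (invmx g) A <-> initial_at D (\adj g) A.
  rewrite adjE //; split; first exact: initial_atZ.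
  move=> /(initial_atZ (invr_neq0 gdet)).
  by rewrite scalerA mulVf // scale1r.
apply/asboolP/idP => [/gE/initial_at_rank|/(initial_at_rank rk)/gE//].
exact.
Qed.

Lemma ext_shift_down : down_closed (ext_shift a D).
Proof.
have [h _ /initial_at_rank hP] := exists_generic.
move=> F G FG GF; apply: contraLR FG => /hP /(initial_at_up Ddown GF).
by move/hP.
Qed.

Lemma ext_shift_set0 : set0 \in D -> set0 \in ext_shift a D.
Proof.
move=> D0; apply/negPn/negP => /(ext_shiftP Ddown)[x [x0 lt h0]].
have := h0 _ D0; rewrite gl_act_coef (bigD1 set0) //= enum_set0 /= eqxx mulr1.
rewrite big1 ?addr0 => [/eqP|B B0]; first by rewrite (negbTE x0).
rewrite lincoef_card ?mulr0 // -cardE cards0 eq_sym cards_eq0 //.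
Qed.

(** A single [h] is chosen for which both [h] and its row operation have the generic ranks, so that
    [initial_at_exchange] passes from one to the other. *)
Lemma ext_shift_exchange A i j : i \in A -> j \notin A -> (i < j)%N ->
  A \notin ext_shift a D -> j |: A :\ i \notin ext_shift a D.
Proof.
move=> iA jA lij; have ij : i != j by apply: contraTneq lij => ->; rewrite ltnn.
pose X := gen_matrix K n; pose t := map_mx (@mpolyC (n * n) K) (addrow i j K).
pose N (Ab : T * bool) := lexmx (if Ab.2 then t *m X else X) Ab.1.1 Ab.1.2.
have tE (L : fieldType) (f : {rmorphism K -> L}) (m : 'M[L]_n) :
    map_mx (mxeval f m) t = addrow i j L.
  apply/matrixP => k l; rewrite !mxE /mxeval mmapC -[LHS]/(f _) rmorphD !rmorph_nat.
  by [].
have NE (L : fieldType) (f : {rmorphism K -> L}) (m : 'M[L]_n) Ab :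
    map_mx (mxeval f m) (N Ab) =
    lexmx (if Ab.2 then addrow i j L *m m else m) Ab.1.1 Ab.1.2.
  rewrite lexmx_eval; case: (Ab.2); last by rewrite gen_matrix_eval.
  by rewrite map_mxM tE gen_matrix_eval.
have [h _ hr] := rank_eval_generic Kinf N ha.
have {}hr As b : \rank (lexmx (if b then addrow i j K *m h else h) As.1 As.2) =
    \rank (lexmx (if b then addrow i j K' *m a else a) As.1 As.2).
  by have := hr (As, b); rewrite !NE.
have tr (As : T) : \rank (lexmx (addrow i j K *m h) As.1 As.2)
    = \rank (lexmx a As.1 As.2).
  apply/eqP; rewrite eqn_leq rank_lexmx_le (hr As true) /=.
  (* The row operation is invertible: applied to [(1%:M - delta_mx i j) *m g] it gives back [g],
     which has generic ranks, so it cannot make the ranks at [a] drop. *)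
  have [g _ <-] := exists_generic.
  have := rank_eval_le (idfun : {rmorphism K -> K}) ((1%:M - delta_mx i j) *m g)
    (N (As, true)) ha.
  rewrite !NE /= mulmxA (_ : addrow i j K *m _ = 1%:M) ?mul1mx //.
  rewrite /addrow mulmxBr mulmx1 mulmxDl mul1mx mul_delta_mx_0 1?eq_sym //.
  by rewrite addr0 addrK.
move=> /(initial_at_rank tr)/(initial_at_exchange iA jA lij).
by apply: (iffRL (initial_at_rank _ _)) => As; exact: (hr As false).
Qed.

End GenericInitialIdeal.

(** * Minimal nonfaces and annihilator numbers *)

Section MinimalNonfaces.
Variables (n : nat) (D : {set {set 'I_n}}).
Hypothesis Ddown : down_closed D.
Implicit Types (A B C F u : {set 'I_n}) (i j k l : 'I_n).

Definition min_nonfaces : {set {set 'I_n}} :=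
  [set A : {set 'I_n} | (A \notin D) && [forall i in A, A :\ i \in D]].

Lemma min_nonfacesP A :
  reflect (A \notin D /\ forall i, i \in A -> A :\ i \in D) (A \in min_nonfaces).
Proof.
rewrite inE; apply: (iffP andP) => -[AD h]; split=> //.
  by move=> i iA; move/forall_inP: h => /(_ i iA).
exact/forall_inP.
Qed.

Lemma min_nonface_sub A B : A \in min_nonfaces -> B \notin D -> B \subset A -> B = A.
Proof.
move=> /min_nonfacesP[AD h] BD BA; apply/eqP; rewrite eqEsubset BA /=.
apply/subsetP => i iA; apply: contraNT BD => iB; apply: Ddown (h i iA) _.
apply/subsetP => k kB; rewrite !inE (subsetP BA) // andbT.
by apply: contraNneq iB => <-.
Qed.

Lemma exists_min_nonface A : A \notin D -> exists2 B, B \in min_nonfaces & B \subset A.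
Proof.
move=> AD; have [B /minsetP[BD h] BA] := minset_exists (P := [pred B | B \notin D]) AD.
exists B => //; apply/min_nonfacesP; split=> // i iB; apply: contraT => BiD.
have /setP/(_ i) := h (B :\ i) BiD (subD1set _ _).
by rewrite !inE eqxx iB.
Qed.

Lemma upset_min_nonfaces : upset min_nonfaces = ~: D.
Proof.
apply/setP => A; rewrite [RHS]inE; apply/mem_upset/idP => [[B /min_nonfacesP[BD _] BA]|].
  by apply: contra BD => AD; exact: Ddown AD BA.
exact: exists_min_nonface.
Qed.

Variable K : fieldType.

Lemma monspan_inj (P Q : {set {set 'I_n}}) : monspan K P = monspan K Q -> P = Q.
Proof. by move=> e; apply/setP => A; rewrite -!(emon_monspan K) e. Qed.

(** Every set of monomial generators contains the minimal nonfaces, which already generate; hence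
    the minimal generating set is unique. *)
Lemma emon_gensE : emon_gens (face_ideal K D) = min_nonfaces.
Proof.
have genE G : emon_generate (face_ideal K D) G = (upset G == ~: D).
  rewrite /emon_generate eideal_mon face_ideal_monspan //.
  by apply/eqP/eqP => [/monspan_inj|->].
have minG G : upset G = ~: D -> min_nonfaces \subset G.
  move=> GD; apply/subsetP => A Am.
  have [AD _] := min_nonfacesP _ Am.
  have: A \in upset G by rewrite GD inE.
  case/mem_upset => B BG BA; suff <- : B = A by [].
  apply: min_nonface_sub => //; rewrite -in_setC -GD.
  exact: (subsetP (sub_upset G)).
have gm : minset (emon_generate (face_ideal K D)) min_nonfaces.
  apply/minsetP; split; first by rewrite genE upset_min_nonfaces.
  move=> G; rewrite genE => /eqP/minG mG Gm; apply/eqP.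
  by rewrite eqEsubset Gm.
apply: xget_unique => // G /minsetP[].
rewrite genE => /eqP/minG mG h; apply/esym/h => //.
by rewrite genE upset_min_nonfaces.
Qed.

Lemma emin_isP A l : reflect (l \in A /\ forall k, k \in A -> (l <= k)%N) (emin_is A l).
Proof.
apply: (iffP andP) => -[lA h]; split=> //.
  by move=> k kA; move/forall_inP: h => /(_ k kA).
exact/forall_inP.
Qed.

Hypothesis Dexchange : forall A i j, i \in A -> j \notin A -> (i < j)%N ->
  A \notin D -> j |: A :\ i \notin D.

Lemma eideal_evar (S : {set 'I_n}) :
  eideal [seq evar K k | k in S] =
  monspan K [set A : {set 'I_n} | [exists k in A, k \in S]].
Proof.
transitivity (eideal [seq emon K A | A in [set [set k] | k in S]]).
  rewrite /eideal; congr ((fullv * _ * fullv)%VS).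
  apply/eqP; rewrite eqEsubv; apply/andP; split; apply/span_subvP => x /mapP[].
    move=> k; rewrite mem_enum => kS ->; apply: memv_span.
    by apply: map_f; rewrite mem_enum imset_f.
  move=> A; rewrite mem_enum => /imsetP[k kS ->] ->; apply: memv_span.
  by rewrite -/(evar K k); apply: map_f; rewrite mem_enum.
rewrite eideal_mon; congr monspan; apply/setP => A; rewrite [RHS]inE.
apply/mem_upset/exists_inP => [[_ /imsetP[k kS ->]]|[k kA kS]].
  by rewrite sub1set => kA; exists k.
by exists [set k]; rewrite ?imset_f // sub1set.
Qed.

Lemma alpha_min_nonfaces l (j : int) :
  alpha (@evar K n) (face_ideal K D) l j =
  #|[set A in min_nonfaces | ((#|A| : int) == j + 1) && emin_is A l]|.
Proof.
rewrite /alpha /= eideal_evar face_ideal_monspan // monspanD.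
set NS := _ :|: _.
have NSE A : (A \in NS) = (A \notin D) || [exists k in A, (k < l)%N].
  rewrite !inE; congr (_ || _); apply: eq_existsb => k; by rewrite inE.
pose Ej (d : int) := [set A : {set 'I_n} | (#|A| : int) == d].
have EjE d : ecomp K n d = monspan K (Ej d) by [].
(* Multiplication by [e_l] kills the monomials containing [l] and sends any other [e_A] to
   [e_(l |: A)] up to sign. Cycles and boundaries are therefore spanned by monomials, with index
   sets [ZS] and [BS]. *)
pose ZS := [set A : {set 'I_n} | ((#|A| : int) == j) && ((l \in A) || (l |: A \in NS))].
pose BS := [set A : {set 'I_n} | ((#|A| : int) == j) && ((l \in A) || (A \in NS))].
have -> : (ecomp K n j :&: amulr (evar K l) @^-1: monspan K NS)%VS = monspan K ZS.
  apply/vspaceP => x; rewrite memv_cap -memv_preim lfunE /= EjE.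
  apply/andP/idP => [[/mem_monspan xj /mem_monspan xN]|/mem_monspan xZ].
    apply/mem_monspan => A; rewrite inE negb_and => /orP[Aj|].
      by apply: xj; rewrite inE.
    rewrite negb_or => /andP[lA /xN]; rewrite emon_mulE sub1set setU11.
    rewrite setU1K //= => /eqP; rewrite mulf_eq0 => /orP[/eqP//|].
    by rewrite (negbTE (_ : esign K A [set l] != 0)) // esign_neq0 disjoint_sym disjoints1.
  split; apply/mem_monspan => A AN.
    by apply: xZ; move: AN; rewrite !inE => /negbTE->.
  rewrite emon_mulE sub1set; case: ifP => // lA; rewrite xZ ?mul0r //.
  by rewrite inE negb_and in_setD1 eqxx setD1K //= AN orbT.
have -> : (amulr (evar K l) @: ecomp K n (j - 1) + monspan K NS :&: ecomp K n j)%VS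
    = monspan K BS.
  rewrite !EjE monspanI; apply/eqP; rewrite eqEsubv subv_add; apply/andP; split.
    apply/andP; split; last first.
      apply: monspan_sub; apply/subsetP => A; rewrite !inE => /andP[-> ->].
      by rewrite orbT.
    apply/subvP => x /memv_imgP[y /mem_monspan yj ->]; apply/mem_monspan => A.
    rewrite lfunE /= emon_mulE sub1set; case: ifP => // lA.
    rewrite inE lA andbT => Aj; rewrite yj ?mul0r // inE.
    apply: contra Aj; rewrite (cardsD1 l A) lA => /eqP.
    by rewrite -[_ :\: _]/(_ :\ _) PoszD => ->; rewrite addrC subrK.
  apply/span_subvP => x /mapP[A]; rewrite mem_enum inE => /andP[Aj].
  have [lA _ ->|lA /= AN ->] := boolP (l \in A); last first.
    by apply: (subvP (addvSr _ _)); rewrite emon_monspan inE AN inE.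
  apply: (subvP (addvSl _ _)).
  have -> : emon K A = amulr (evar K l) ((esign K (A :\ l) [set l])^-1 *: emon K (A :\ l)).
    rewrite lfunE /= -scalerAl emonM scalerA mulVf ?scale1r.
      by rewrite setUC setD1K.
    by rewrite esign_neq0 disjoint_sym disjoints1 !inE eqxx.
  apply/memv_img/memvZ; rewrite emon_monspan inE.
  by move: Aj; rewrite (cardsD1 l A) lA PoszD => /eqP <-; rewrite addrC addKr.
rewrite !dim_monspan; have BZ : BS \subset ZS.
  apply/subsetP => A; rewrite !inE => /andP[-> /orP[->//|]].
  have [lA /=|lA /=] := boolP (l \in A); first by [].
  rewrite /= => /orP[AD|/exists_inP[k kA kl]]; last first.
    by apply/orP; right; apply/exists_inP; exists k => //; rewrite inE kA orbT.
  by apply/orP; left; apply: contra AD => /Ddown; apply; exact: subsetUr.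
rewrite -{1}(setIidPr BZ) -cardsD.
have ZB A : (A \in ZS :\: BS) =
    [&& (#|A| : int) == j, l \notin A, A \notin NS & l |: A \in NS].
  rewrite [LHS]inE [_ \in BS]inE [_ \in ZS]inE.
  by case: eqP => //= _; case: (l \in A) => //=.
rewrite -[LHS](@card_in_imset _ _ (fun A => l |: A)); last first.
  move=> A B; rewrite !ZB => /and4P[_ lA _ _] /and4P[_ lB _ _] e.
  by rewrite -(setU1K lA) e setU1K.
apply: eq_card => A; rewrite [RHS]inE; apply/imsetP/and3P.
  move=> [B]; rewrite ZB !NSE negb_or negbK => /and4P[Bj lB /andP[BD Bl] lBN] ->.
  have Bgt k : k \in B -> (l < k)%N.
    move=> kB; rewrite ltn_neqAle; apply/andP; split.
      by apply: contraNneq lB => /val_inj->.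
    by rewrite leqNgt; apply: contra Bl => kl; apply/exists_inP; exists k.
  have lBD : l |: B \notin D.
    case/orP: lBN => // /exists_inP[k]; rewrite !inE => /predU1P[->|/Bgt lk kl].
      by rewrite ltnn.
    by have := ltn_trans lk kl; rewrite ltnn.
  split.
  - apply/min_nonfacesP; split=> // i; rewrite !inE => /predU1P[->|iB].
      by rewrite setU1K.
    (* Were [(l |: B) :\ i] a nonface, exchanging its element [l] for the larger [i] would make [B]
       a nonface. *)
    apply: contraLR BD => h; have il : i != l by apply: contraTneq iB => ->.
    have := Dexchange (i := l) (j := i) _ _ (Bgt _ iB) h.
    rewrite !inE eqxx eq_sym il /= eqxx => /(_ isT isT).
    suff -> : i |: ((l |: B) :\ i) :\ l = B by [].
    apply/setP => k; rewrite !inE; have [->|ki] /= := eqVneq k i; first by rewrite iB.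
    by have [->|//] := eqVneq k l; rewrite (negbTE lB).
  - by rewrite cardsU1 lB PoszD addrC (eqP Bj).
  - apply/emin_isP; split; first by rewrite setU11.
    by move=> k; rewrite !inE => /predU1P[->//|/Bgt/ltnW].
move=> [Am Aj /emin_isP[lA hl]]; have [AD Ai] := min_nonfacesP _ Am.
exists (A :\ l); last by rewrite setD1K.
rewrite ZB !NSE negb_or negbK !setD1K // AD Ai // !inE eqxx /= andbT.
apply/andP; split.
  by move: Aj; rewrite (cardsD1 l A) lA PoszD addrC => /eqP/addIr->.
by apply/exists_inP => -[k]; rewrite !inE => /andP[_ /hl]; rewrite leqNgt => /negbTE->.
Qed.

Lemma count_emon_gensE l (j : int) :
  count_emon_gens (face_ideal K D) j l =
  #|[set A in min_nonfaces | ((#|A| : int) == j) && emin_is A l]|.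
Proof. by rewrite /count_emon_gens emon_gensE. Qed.

End MinimalNonfaces.

(** * Squarefree monomial ideals *)

Section MonomialIdeals.
Variables (K : fieldType) (n : nat).
Local Notation S := {mpoly K[n]}.
Implicit Types (p q : S) (m g : 'X_{1..n}) (F A : {set 'I_n}) (X : {set {set 'I_n}}).

Lemma pideal_monP (G : set 'X_{1..n}) p :
  pideal [set q | exists2 g, G g & q = 'X_[g]]%classic p <->
  (forall m, m \in msupp p -> exists2 g, G g & (g <= m)%MM).
Proof.
split=> [[k [c [x [xG ->]]]] m|h].
  rewrite mcoeff_msupp raddf_sum /= => nz.
  have [i nzi] : exists i, (c i * x i)@_m != 0.
    apply/existsP; apply: contraNT nz; rewrite negb_exists => /forallP h.
    by rewrite big1 // => i _; apply/eqP; have := h i; rewrite negbK.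
  have [g Gg xE] := xG i; exists g => //.
  have : m \in msupp (c i * x i) by rewrite mcoeff_msupp.
  rewrite xE (perm_mem (msuppMX _ _)) => /mapP[m' _ ->].
  exact: lem_addr.
pose r : seq 'X_{1..n} := msupp p.
have /fin_all_exists[g gP] : forall i : 'I_(size r),
    exists g, G g /\ (g <= nth 0%MM r i)%MM.
  by move=> i; have [g Gg gi] := h _ (mem_nth 0%MM (ltn_ord i)); exists g.
exists (size r), (fun i : 'I_(size r) => p@_(nth 0%MM r i) *: 'X_[(nth 0%MM r i - g i)%MM]),
  (fun i => 'X_[g i]); split=> [i|].
  by exists (g i); [case: (gP i)|].
rewrite {1}[p]mpolyE (big_nth 0%MM) big_mkord; apply: eq_bigr => i _.
by rewrite -scalerAl -mpolyXD submK //; case: (gP i).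
Qed.

Definition smon F : 'X_{1..n} := [multinom (i \in F : nat) | i < n].

Definition sqle F m : bool := [forall i in F, (0 < m i)%N].

Lemma smonE F i : smon F i = (i \in F).
Proof. by rewrite mnmE. Qed.

Lemma smon_le F m : (smon F <= m)%MM = sqle F m.
Proof.
apply/mnm_lepP/forall_inP => h i; last by rewrite smonE; case: (boolP (i \in F)) => // /h.
by have := h i; rewrite smonE => + iF; rewrite iF.
Qed.

Lemma smon_sub F A : (smon F <= smon A)%MM = (F \subset A).
Proof.
rewrite smon_le; apply/forall_inP/subsetP => h i /h; rewrite smonE.
  by case: (i \in A).
by move=> ->.
Qed.

Lemma smon_inj : injective smon.
Proof.
move=> F A e; apply/setP => i; have := congr1 (fun m : 'X_{1..n} => m i) e.
by rewrite !smonE; case: (i \in F); case: (i \in A).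
Qed.

Lemma mdeg_smon F : mdeg (smon F) = #|F|.
Proof.
rewrite mdegE -sum1_card [RHS]big_mkcond; apply: eq_bigr => i _.
by rewrite smonE; case: (i \in F).
Qed.

Lemma pmin_is_smon F l : pmin_is (smon F) l = emin_is F l.
Proof.
rewrite /pmin_is /emin_is smonE lt0b; congr (_ && _); apply: eq_forallb => k.
by rewrite smonE lt0b.
Qed.

Lemma prod_smon F : \prod_(i in F) 'X_i = 'X_[smon F] :> S.
Proof.
rewrite mprodXE; congr 'X_[_]; apply/mnmP => i; rewrite mnm_sumE smonE.
have [iF|iF] := boolP (i \in F).
  rewrite (bigD1 i) //= mnm1E eqxx big1 // => j /andP[_ ji].
  by rewrite mnm1E (negbTE ji).
rewrite big1 // => j jF; rewrite mnm1E; case: eqP => // ji.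
by move: iF; rewrite -ji jF.
Qed.

(** The ideal generated by the [x_F] with [F] in [X], described by supports as in [pideal_monP], so
    that membership involves no choice of coefficients. *)
Definition mideal X : set S :=
  fun p => forall m, m \in msupp p -> exists2 F, F \in X & sqle F m.

Lemma stanley_reisnerE D :
  stanley_reisner_ideal K D = mideal (~: D).
Proof.
rewrite /stanley_reisner_ideal.
have -> : [set p | exists2 F : {set 'I_n}, F \notin D & p = \prod_(i in F) 'X_i :> S]%classic
    = [set q | exists2 g, [set g | exists2 F : {set 'I_n}, F \notin D & g = smon F] g
        & q = 'X_[g]]%classic.
  apply/predeqP => p; split=> [[F FD ->]|[_ [F FD ->] ->]].
    by exists (smon F); [exists F|rewrite prod_smon].
  by exists F; rewrite ?prod_smon.
apply/predeqP => p; rewrite pideal_monP; split=> h m /h.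
  by move=> [_ [F FD ->]]; rewrite smon_le => Fm; exists F; rewrite // inE.
by move=> [F]; rewrite inE -smon_le => FD Fm; exists (smon F) => //; exists F.
Qed.

Lemma sqleS F A m : F \subset A -> sqle A m -> sqle F m.
Proof. by rewrite -!smon_le -smon_sub; exact: lepm_trans. Qed.

Lemma mideal_upset X : mideal (upset X) = mideal X.
Proof.
apply/predeqP => p; split=> h m /h [F].
  by move=> /mem_upset[A AX AF] /(sqleS AF) Am; exists A.
by move=> FX Fm; exists F => //; exact: (subsetP (sub_upset X)).
Qed.

Section Generators.
Variable D : {set {set 'I_n}}.
Hypothesis Ddown : down_closed D.

Lemma stanley_reisner_min : stanley_reisner_ideal K D = mideal (min_nonfaces D).
Proof. by rewrite stanley_reisnerE -upset_min_nonfaces // mideal_upset. Qed.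

Lemma pmon_generateP (G : {fset 'X_{1..n}}) :
  pmon_generate (stanley_reisner_ideal K D) G <->
  (forall m, (exists2 g, g \in G & (g <= m)%MM) <->
             (exists2 F, F \in min_nonfaces D & (smon F <= m)%MM)).
Proof.
rewrite /pmon_generate stanley_reisner_min; split=> [e m|h].
  have := congr1 (fun I : set S => I 'X_[m]) e.
  move=> {}e; have : (pideal [set p | exists2 m, m \in G & p = 'X_[m]]%classic ('X_[m] : S))
    <-> mideal (min_nonfaces D) ('X_[m] : S) by rewrite e.
  rewrite (pideal_monP [set m | m \in G]%classic) => {}e; split.
    move=> Gm; have /e/(_ m) : forall m', m' \in msupp ('X_[m] : S) ->
        exists2 g, [set m | m \in G]%classic g & (g <= m')%MM.
      by move=> m'; rewrite msuppX inE => /eqP->.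
    rewrite msuppX inE eqxx => /(_ isT)[F FD]; rewrite -smon_le => Fm.
    by exists F.
  move=> [F FD Fm]; have /e/(_ m) : mideal (min_nonfaces D) ('X_[m] : S).
    by move=> m'; rewrite msuppX inE => /eqP->; exists F; rewrite // -smon_le.
  by rewrite msuppX inE eqxx => /(_ isT).
apply/predeqP => p; rewrite (pideal_monP [set m | m \in G]%classic).
split=> pG m /pG; first by move/h => [F FD]; rewrite smon_le; exists F.
by move=> [F FD]; rewrite -smon_le => Fm; apply/h; exists F.
Qed.

(** A generator dividing [x_F], for a minimal nonface [F], is itself divisible by some [x_A], and
    minimality forces [A = F]; thus [x_F] belongs to every set of monomial generators. *)
Lemma pmon_gensE :
  pmon_gens (stanley_reisner_ideal K D) = [fset smon F | F in min_nonfaces D]%fset.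
Proof.
set G0 := [fset smon F | F in min_nonfaces D]%fset.
have G0gen : pmon_generate (stanley_reisner_ideal K D) G0.
  apply/pmon_generateP => m; split=> [[g /imfsetP[F /= FD ->] Fm]|[F FD Fm]].
    by exists F.
  by exists (smon F) => //; apply/imfsetP; exists F.
have G0min (G : {fset 'X_{1..n}}) :
    pmon_generate (stanley_reisner_ideal K D) G -> (G0 `<=` G)%fset.
  move=> /pmon_generateP h; apply/fsubsetP => m /imfsetP[F /= FD ->].
  have /h[g gG gF] : exists2 A, A \in min_nonfaces D & (smon A <= smon F)%MM.
    by exists F => //; exact: lepm_refl.
  have [A AD Ag] : exists2 A, A \in min_nonfaces D & (smon A <= g)%MM.
    by apply/h; exists g => //; exact: lepm_refl.
  have := lepm_trans Ag gF; rewrite smon_sub => AF.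
  have [AD' _] := min_nonfacesP _ _ AD.
  have AF' := min_nonface_sub Ddown FD AD' AF.
  rewrite AF' in Ag; suff -> : smon F = g by [].
  by apply/mnmP => i; apply/eqP; rewrite eqn_leq (mnm_lepP Ag) (mnm_lepP gF).
apply: xget_unique.
  by split=> // G'; rewrite fproperE => /andP[_ /negP nG] /G0min/nG.
move=> G [/G0min G0G Gmin]; apply/eqP; rewrite eq_sym; apply: contraT => ne.
by have := Gmin G0; rewrite fproperEneq ne G0G => /(_ isT).
Qed.

Lemma count_pmon_gensE (d : int) l :
  count_pmon_gens (stanley_reisner_ideal K D) d l =
  #|[set u in min_nonfaces D | ((#|u| : int) == d) && emin_is u l]|.
Proof.
rewrite /count_pmon_gens pmon_gensE.
transitivity #|` [fset smon u | u in
    [set u in min_nonfaces D | ((#|u| : int) == d) && emin_is u l]]%fset|.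
  congr #|` _|; apply/fsetP => m; apply/imfsetP/imfsetP => /=.
    move=> [_ /andP[/imfsetP[u /= uD ->]] h ->]; exists u => //.
    by move: h; rewrite /= mdeg_smon pmin_is_smon inE uD.
  move=> [u]; rewrite inE => /andP[uD h] ->; exists (smon u) => //.
  apply/andP; split; first by apply/imfsetP; exists u.
  by rewrite /= mdeg_smon pmin_is_smon.
by rewrite card_imfset /= ?cardE //; exact: smon_inj.
Qed.

End Generators.
End MonomialIdeals.

(** * Graded resolutions *)

Section HomogeneousComponents.
Variables (K : fieldType) (n : nat).
Local Notation S := {mpoly K[n]}.
Implicit Types (p q : S) (d e : int) (m : 'X_{1..n}).

Lemma homog_of_degP d p :
  homog_of_deg d p <-> (forall m, (mdeg m : int) != d -> p@_m = 0).
Proof.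
split=> h m; first by move=> md; apply/eqP; rewrite mcoeff_eq0; apply: contra md => /h->.
by rewrite mcoeff_msupp => pm; apply/eqP; apply: contraNT pm => /h->.
Qed.

Definition hcomp d p : S := \sum_(m <- msupp p | (mdeg m : int) == d) p@_m *: 'X_[m].

Lemma mcoeff_hcomp d p m :
  (hcomp d p)@_m = if (mdeg m : int) == d then p@_m else 0.
Proof.
rewrite /hcomp raddf_sum /=.
under eq_bigr do rewrite mcoeffZ mcoeffX.
have [mp|mp] := boolP (m \in msupp p); last first.
  rewrite memN_msupp_eq0 // if_same big1_seq // => m' /andP[_ m'p].
  by case: eqP => [e|_]; [rewrite -e m'p in mp|rewrite mulr0].
rewrite big_mkcond (bigD1_seq m) ?msupp_uniq //= eqxx mulr1 big1 ?addr0 // => m' m'm.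
by rewrite (negbTE m'm) mulr0 if_same.
Qed.

Lemma hcomp0 d : hcomp d 0 = 0.
Proof. by apply/mpolyP => m; rewrite mcoeff_hcomp mcoeff0 if_same. Qed.

Lemma hcompD d p q : hcomp d (p + q) = hcomp d p + hcomp d q.
Proof.
apply/mpolyP => m; rewrite mcoeffD !mcoeff_hcomp mcoeffD.
by case: ifP; rewrite ?addr0.
Qed.

Lemma hcomp_sum (I : Type) (r : seq I) (P : pred I) (f : I -> S) d :
  hcomp d (\sum_(i <- r | P i) f i) = \sum_(i <- r | P i) hcomp d (f i).
Proof.
by elim/big_rec2: _ => [|i y1 y2 _ <-]; rewrite ?hcomp0 // hcompD.
Qed.

Lemma hcomp_homog d p : homog_of_deg d (hcomp d p).
Proof. by apply/homog_of_degP => m md; rewrite mcoeff_hcomp (negbTE md). Qed.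

Lemma hcomp_id d p : homog_of_deg d p -> hcomp d p = p.
Proof.
move=> /homog_of_degP h; apply/mpolyP => m; rewrite mcoeff_hcomp.
by case: ifPn => // /h ->.
Qed.

Lemma hcompM d e p q : homog_of_deg e q -> hcomp (d + e) (p * q) = hcomp d p * q.
Proof.
move=> /homog_of_degP h; apply/mpolyP => m; rewrite mcoeff_hcomp !mcoeffM.
transitivity (\sum_(k : 'X_{1..n < (mdeg m).+1, (mdeg m).+1} | m == (k.1 + k.2)%MM)
    if (mdeg m : int) == d + e then p@_k.1 * q@_k.2 else 0).
  by case: ifP => // _; rewrite big1.
apply: eq_bigr => k /eqP mk; rewrite mcoeff_hcomp.
have [ke|/h->] := eqVneq (mdeg k.2 : int) e; last by rewrite !mulr0 if_same.
rewrite {1}mk mdegD PoszD ke;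
have -> : ((mdeg k.1)%:Z + e == d + e) = ((mdeg k.1 : int) == d).
  by apply/eqP/eqP => [/addIr|->].
by case: ifP; rewrite ?mul0r.
Qed.

Lemma homog0 d : homog_of_deg d (0 : S).
Proof. by move=> m; rewrite msupp0. Qed.

Lemma homogN d p : homog_of_deg d p -> homog_of_deg d (- p).
Proof.
move=> /homog_of_degP h; apply/homog_of_degP => m /h; rewrite mcoeffN => ->.
by rewrite oppr0.
Qed.

Lemma homog_const d p : homog_of_deg d p -> d != 0 -> p@_0%MM = 0.
Proof. by move=> /homog_of_degP h d0; apply: h; rewrite mdeg0 eq_sym. Qed.

End HomogeneousComponents.

Section HomogeneousMatrices.
Variables (K : fieldType) (n : nat).
Local Notation S := {mpoly K[n]}.

Definition homogmx p q (r : 'I_p -> int) (c : 'I_q -> int) (M : 'M[S]_(p, q)) : Prop :=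
  forall a b, homog_of_deg (r a - c b) (M a b).

(** The part of degree 0 of [M], as a map of graded free modules with basis degrees [r] and [c]. By
    [hpartM] it replaces a solution of a homogeneous lifting problem by a homogeneous one. *)
Definition hpart p q (r : 'I_p -> int) (c : 'I_q -> int) (M : 'M[S]_(p, q)) :=
  \matrix_(a, b) hcomp (r a - c b) (M a b).

Lemma hpart_homog p q (r : 'I_p -> int) (c : 'I_q -> int) (M : 'M[S]_(p, q)) :
  homogmx r c (hpart r c M).
Proof. by move=> a b; rewrite mxE; exact: hcomp_homog. Qed.

Lemma hpart_id p q (r : 'I_p -> int) (c : 'I_q -> int) (M : 'M[S]_(p, q)) :
  homogmx r c M -> hpart r c M = M.
Proof. by move=> h; apply/matrixP => a b; rewrite mxE hcomp_id. Qed.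

Lemma hpartM p q k (r : 'I_p -> int) (c : 'I_q -> int) (d : 'I_k -> int)
    (M : 'M[S]_(p, q)) (N : 'M[S]_(q, k)) :
  homogmx c d N -> hpart r d (M *m N) = hpart r c M *m N.
Proof.
move=> h; apply/matrixP => a b; rewrite !mxE hcomp_sum; apply: eq_bigr => l _.
rewrite mxE -(hcompM _ _ (h l b)).
by congr hcomp; rewrite addrA subrK.
Qed.

Lemma homogmxM p q k (r : 'I_p -> int) (c : 'I_q -> int) (d : 'I_k -> int)
    (M : 'M[S]_(p, q)) (N : 'M[S]_(q, k)) :
  homogmx r c M -> homogmx c d N -> homogmx r d (M *m N).
Proof.
by move=> hM hN; rewrite -(hpart_id hM) -(hpartM _ _ hN); exact: hpart_homog.
Qed.

End HomogeneousMatrices.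

Section Resolutions.
Variables (K : fieldType) (n : nat).
Local Notation S := {mpoly K[n]}.
Local Notation resolution := (@graded_free_resolution K n).

Definition graded_ideal (I : set S) : Prop :=
  [/\ I 0, forall p q, I p -> I q -> I (p + q), forall p q, I q -> I (p * q)
    & forall d p, I p -> I (hcomp d p)].

Lemma gideal_sum (I : set S) (T : finType) (f : T -> S) :
  graded_ideal I -> (forall t, I (f t)) -> I (\sum_t f t).
Proof. by move=> [I0 ID _ _] h; elim/big_rec: _ => // t x _; exact: ID. Qed.

Lemma gidealN (I : set S) p : graded_ideal I -> I p -> I (- p).
Proof. by move=> [_ _ IM _] /(IM (-1)); rewrite mulN1r. Qed.

Lemma gidealB (I : set S) p q : graded_ideal I -> I p -> I q -> I (p - q).
Proof. by move=> hI Ip /(gidealN hI); case: hI => _ ID _ _; exact: ID. Qed.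

Lemma gideal_subl (I : set S) p q : graded_ideal I -> I (p - q) -> I q -> I p.
Proof. by move=> [_ ID _ _] h /(ID _ _ h); rewrite subrK. Qed.

Lemma gideal_subr (I : set S) p q : graded_ideal I -> I (p - q) -> I p -> I q.
Proof. by move=> hI h Ip; have := gidealB hI Ip h; rewrite opprB addrC subrK. Qed.

Definition inI (I : set S) p q (V : 'M[S]_(p, q)) : Prop := forall a b, I (V a b).

Lemma inI_mull (I : set S) p q k (M : 'M[S]_(p, q)) (V : 'M[S]_(q, k)) :
  graded_ideal I -> inI I V -> inI I (M *m V).
Proof.
move=> hI hV a b; rewrite mxE; apply: gideal_sum => // t.
by case: hI => _ _ IM _; exact: IM.
Qed.

Lemma inI_cv (I : set S) p (V : 'cV[S]_p) : inI I V <-> forall a, I (V a 0).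
Proof. by split=> h a // b; rewrite ord1. Qed.

Section Exactness.
Variables (I : set S) (F : resolution I).

Lemma resolution_aug p (V : 'M[S]_(p, frank F 0)) :
  inI I (V *m fraug F) <-> exists W, V = W *m frd F 0.
Proof.
split=> [h|[W ->] a b]; last first.
  have := (fraug_exact (row a (W *m frd F 0))).2.
  rewrite -row_mul mxE (ord1 b); apply.
  by exists (row a W); rewrite row_mul.
have /fin_all_exists[w wP] : forall a, exists w, row a V = w *m frd F 0.
  by move=> a; apply/fraug_exact; rewrite -row_mul mxE.
exists (\matrix_a w a); apply/row_matrixP => a.
by rewrite row_mul rowK.
Qed.

Lemma resolution_frd i p (V : 'M[S]_(p, frank F i.+1)) :
  V *m frd F i = 0 <-> exists W, V = W *m frd F i.+1.
Proof.
split=> [h|[W ->]]; last first.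
  apply/row_matrixP => a; rewrite row0 row_mul; apply/frd_exact.
  by exists (row a W); rewrite row_mul.
have /fin_all_exists[w wP] : forall a, exists w, row a V = w *m frd F i.+1.
  by move=> a; apply/frd_exact; rewrite -row_mul h row0.
exists (\matrix_a w a); apply/row_matrixP => a.
by rewrite row_mul rowK.
Qed.

Lemma frd_frd i : frd F i.+1 *m frd F i = 0.
Proof. by apply/resolution_frd; exists 1%:M; rewrite mul1mx. Qed.

Lemma frd_aug : inI I (frd F 0 *m fraug F).
Proof. by apply/resolution_aug; exists 1%:M; rewrite mul1mx. Qed.

Lemma frd_homogmx i : homogmx (@frdeg _ _ _ F i.+1) (@frdeg _ _ _ F i) (frd F i).
Proof. move=> a b; exact: frd_homog. Qed.

End Exactness.

(** * Chain maps between resolutions *)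

Section Lifting.
Variables (I J : set S) (F : resolution I) (G : resolution J) (u : S) (d : nat).
Hypothesis hI : graded_ideal I.
Hypothesis uhomog : homog_of_deg (d : int) u.
Hypothesis uJ : forall p, J p -> I (u * p).

Let dF i := @frdeg _ _ _ F i.
Let dG i (a : 'I_(frank G i)) := frdeg a + (d : int).

Let frd_homogG i : homogmx (@dG i.+1) (@dG i) (frd G i).
Proof.
move=> a b; rewrite /dG opprD addrACA subrr addr0; exact: frd_homog.
Qed.

Let lift_aug : exists2 M : 'M[S]_(frank G 0, frank F 0),
  homogmx (@dG 0) (@dF 0) M & inI I (M *m fraug F - u *: fraug G).
Proof.
have [v vP] := fraug_surj F.
(* Since [v] represents 1 in [S/I], [M *m fraug F] agrees with [u *: fraug G] modulo [I]; only
   homogeneity is still missing. *)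
pose M := u *: fraug G *m v.
have augF : homogmx (@dF 0) (fun _ : 'I_1 => 0) (fraug F).
  by move=> a b; rewrite subr0 ord1; exact: fraug_homog.
exists (hpart (@dG 0) (@dF 0) M); first exact: hpart_homog.
rewrite -(hpartM _ _ augF).
have augG : homogmx (@dG 0) (fun _ : 'I_1 => 0) (u *: fraug G).
  move=> a b; rewrite subr0 ord1 mxE mulrC.
  have h := hcompM (frdeg a) (fraug G a 0) uhomog.
  by rewrite -(hcomp_id (@fraug_homog _ _ _ G a)) -h; exact: hcomp_homog.
rewrite -(hpart_id augG) => a b.
have -> : (hpart (@dG 0) (fun _ => 0) (M *m fraug F) -
    hpart (@dG 0) (fun _ => 0) (u *: fraug G)) a b =
    hcomp (dG a - 0) ((M *m fraug F - u *: fraug G) a b).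
  by rewrite !mxE hcompD; congr (_ + _); apply/mpolyP => m;
    rewrite mcoeffN !mcoeff_hcomp mcoeffN; case: ifP => _; rewrite ?oppr0.
case: (hI) => _ _ IM Ih; apply: Ih.
have -> : (M *m fraug F - u *: fraug G) a b =
    - (u * fraug G a b) * (1 - (v *m fraug F) 0 0).
  rewrite /M -mulmxA; move: (v *m fraug F) => W.
  rewrite !mxE big_ord1 mxE (ord1 b) mulNr mulrBr mulr1 opprB.
  by [].
exact: IM.
Qed.

(** The conditions are part of the type, with 0 as default value, so that [lift_map] can be defined
    by recursion before [lift_mapP] shows that a lift always exists. *)
Let step i (M : 'M[S]_(frank G i, frank F i)) : {M' : 'M[S]_(frank G i.+1, frank F i.+1) |
  (exists W, frd G i *m M = W *m frd F i) -> homogmx (@dG i) (@dF i) M ->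
  homogmx (@dG i.+1) (@dF i.+1) M' /\ frd G i *m M = M' *m frd F i}.
Proof.
apply: cid; have [[W WE]|nW] := pselect (exists W, frd G i *m M = W *m frd F i);
  last by exists 0.
exists (hpart (@dG i.+1) (@dF i.+1) W) => _ hM; split; first exact: hpart_homog.
rewrite -(hpartM _ _ (@frd_homogmx _ F i)) -WE hpart_id //.
exact: homogmxM (@frd_homogG i) hM.
Qed.

Let M0 := projT1 (cid2 lift_aug).

Let Fixpoint lift_map i : 'M[S]_(frank G i, frank F i) :=
  if i is i'.+1 then projT1 (step (lift_map i')) else M0.

Let lift_mapS i : lift_map i.+1 = projT1 (step (lift_map i)). Proof. by []. Qed.

Let lift_map_aug : inI I (lift_map 0 *m fraug F - u *: fraug G).
Proof. by rewrite /= /M0; case: (cid2 _). Qed.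

Let lift_mapP i : homogmx (@dG i) (@dF i) (lift_map i) /\
  frd G i *m lift_map i = lift_map i.+1 *m frd F i.
Proof.
elim: i => [|i [hi IH]].
  have h0 : homogmx (@dG 0) (@dF 0) (lift_map 0) by rewrite /= /M0; case: (cid2 _).
  split=> //=; case: step => M' /= [] //; apply/resolution_aug.
  rewrite -mulmxA => a b.
  apply: (gideal_subl (q := (frd G 0 *m (u *: fraug G)) a b) hI).
    have -> : (frd G 0 *m (M0 *m fraug F)) a b - (frd G 0 *m (u *: fraug G)) a b
        = (frd G 0 *m (M0 *m fraug F - u *: fraug G)) a b.
      by rewrite mulmxBr !mxE.
    exact: (inI_mull _ hI lift_map_aug).
  by rewrite -scalemxAr mxE; apply: uJ; exact: frd_aug.
have hS : homogmx (@dG i.+1) (@dF i.+1) (lift_map i.+1).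
  rewrite /=; case: step => M' /= [] //; exists (lift_map i.+1); exact: IH.
split=> //; rewrite [lift_map i.+2]lift_mapS; case: step => M' /= [] //.
by apply/(resolution_frd (F := F)); rewrite -mulmxA -IH mulmxA frd_frd mul0mx.
Qed.

(** Lifts multiplication by [u], from [S/J] to [S/I]; the shift by [d] makes it homogeneous. It
    serves with [u = 1] to compare two resolutions, and with [J] the colon ideal of [I] by [u] to
    form mapping cones. *)
Lemma exists_lift : exists phi : forall i, 'M[S]_(frank G i, frank F i),
  [/\ forall i, homogmx (fun a => frdeg a + (d : int)) (@frdeg _ _ _ F i) (phi i),
      inI I (phi 0 *m fraug F - u *: fraug G)
    & forall i, frd G i *m phi i = phi i.+1 *m frd F i].
Proof.
by exists lift_map; split=> [i||i]; [case: (lift_mapP i)| |case: (lift_mapP i)].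
Qed.

End Lifting.
End Resolutions.

(** * Independence of the minimal resolution *)

Section BettiUniqueness.
Variables (K : fieldType) (n : nat) (I : set {mpoly K[n]}).
Local Notation S := {mpoly K[n]}.
Local Notation resolution := (@graded_free_resolution K n I).
Hypothesis hI : graded_ideal I.

Definition betti (F : resolution) i (j : int) :=
  #|[set a : 'I_(frank F i) | frdeg a == j]|.

Let c0 p q (M : 'M[S]_(p, q)) : 'M[K]_(p, q) := map_mx (mcoeff 0%MM) M.

(** Constant terms of a homogeneous matrix vanish between basis elements of different degrees, so
    the block of [c0 P] in degree [j] has a right inverse. *)
Lemma homogmx_block p q (r : 'I_p -> int) (c : 'I_q -> int) (P : 'M[S]_(p, q))
    (Q : 'M[S]_(q, p)) (j : int) :
  homogmx r c P -> c0 (P *m Q) = 1%:M ->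
  (#|[set a | r a == j]| <= #|[set b | c b == j]|)%N.
Proof.
move=> hP; rewrite /c0 map_mxM => PQ.
set X := [set a | r a == j]; set Y := [set b | c b == j].
apply: (@mulmx1_min _ _ _
  (mxsub (fun a : 'I_#|X| => enum_val a) (fun b : 'I_#|Y| => enum_val b) (c0 P))
  (mxsub (fun b : 'I_#|Y| => enum_val b) (fun a : 'I_#|X| => enum_val a) (c0 Q))).
apply/matrixP => a a'; have := congr1 (fun M : 'M_p => M (enum_val a) (enum_val a')) PQ.
rewrite !mxE (inj_eq enum_val_inj) => <-.
rewrite [RHS](bigID (mem Y)) /= [X in _ = _ + X]big1 ?addr0 => [|b bY].
  by rewrite [RHS]big_enum_val; apply: eq_bigr => b _; rewrite !mxE.
rewrite !mxE (homog_const (hP _ _)) ?mul0r // subr_eq0 eq_sym.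
have := enum_valP a; rewrite inE => /eqP->.
by move: bY; rewrite inE.
Qed.

(* The composite [chi] of lifts of the identity in both directions is homotopic
   to the identity, hence is the identity modulo the variables. *)
Lemma betti_le (F G : resolution) i j : minimal_resolution F -> (betti F i j <= betti G i j)%N.
Proof.
move=> minF.
have h1 : homog_of_deg (0%N : int) (1 : S).
  by move=> m; rewrite msupp1 inE => /eqP->; rewrite mdeg0.
have hI1 p : I p -> I (1 * p) by rewrite mul1r.
have [phi [hphi phi0 phid]] := exists_lift G F hI h1 hI1.
have [psi [hpsi psi0 psid]] := exists_lift F G hI h1 hI1.
pose chi k := phi k *m psi k.
have chid k : frd F k *m chi k = chi k.+1 *m frd F k.
  by rewrite /chi mulmxA phid -!mulmxA psid.
have c0d k : c0 (frd F k) = 0.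
  by apply/matrixP => a b; rewrite !mxE; exact: minF.
(* [H] is the homotopy in degree [k]; the vanishing is the cycle condition from which it is built in
   degree [k.+1]. *)
have chiP k : (exists H, frd F k *m (chi k - 1%:M - H *m frd F k) = 0) /\
    c0 (chi k) = 1%:M.
  elim: k => [|k [[H HE] _]].
    have [H HE] : exists H, chi 0 - 1%:M = H *m frd F 0.
      apply/(resolution_aug (F := F)).
      have -> : (chi 0 - 1%:M) *m fraug F =
          phi 0 *m (psi 0 *m fraug F - 1 *: fraug G) + (phi 0 *m fraug G - 1 *: fraug F).
        rewrite mulmxBl mulmxBr !scale1r mul1mx mulmxA -/(chi 0).
        by rewrite addrA subrK.
      move=> a b; rewrite mxE; case: (hI) => _ ID _ _; apply: ID; last exact: phi0.
      exact: inI_mull.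
    split; first by exists H; rewrite HE subrr mulmx0.
    rewrite -[chi 0](subrK 1%:M) HE /c0 map_mxD map_mxM -/(c0 _) -/(c0 (frd F 0)).
    by rewrite c0d mulmx0 add0r map_mx1.
  have [H' H'E] : exists H', chi k.+1 - 1%:M - frd F k *m H = H' *m frd F k.+1.
    apply/(resolution_frd (F := F)); rewrite !mulmxBl mul1mx -chid.
    by move: HE; rewrite !mulmxBr mulmx1 !mulmxA.
  have E : chi k.+1 - 1%:M - H' *m frd F k.+1 = frd F k *m H.
    by rewrite -H'E opprB addrCA subrr addr0.
  split; first by exists H'; rewrite E mulmxA frd_frd mul0mx.
  rewrite -[chi k.+1](subrK 1%:M) -[chi _ - _](subrK (H' *m frd F k.+1)) E.
  rewrite /c0 !map_mxD !map_mxM -!/(c0 _) !c0d mul0mx mulmx0 !add0r.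
  exact: map_mx1.
apply: (homogmx_block (P := phi i) (Q := psi i)); last by case: (chiP i).
by move=> a b; have := hphi i a b; rewrite addr0.
Qed.

Lemma graded_bettiE (F : resolution) i j :
  minimal_resolution F -> graded_betti I i j = betti F i j.
Proof.
move=> minF; apply: xget_unique; first by exists F.
move=> b [G minG ->]; apply/eqP; rewrite eqn_leq.
by rewrite (betti_le G i j minF) (betti_le F i j minG).
Qed.

End BettiUniqueness.

(** * Mapping cones for colon ideals *)

Section MappingCone.
Variables (K : fieldType) (n : nat).
Local Notation S := {mpoly K[n]}.
Local Notation resolution := (@graded_free_resolution K n).
Variables (I J : set S) (F : resolution I) (G : resolution J) (u : S) (d : nat).
Hypothesis hI : graded_ideal I.
Hypothesis uhomog : homog_of_deg (d : int) u.
Hypothesis colonJ : forall p, J p <-> I (u * p).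

Definition add_gen : set S := [set p | exists s, I (p - s * u)]%classic.

Variable phi : forall i, 'M[S]_(frank G i, frank F i).
Let dG i (a : 'I_(frank G i)) : int := frdeg a + (d : int).
Hypothesis hphi : forall i, homogmx (@dG i) (@frdeg _ _ _ F i) (phi i).
Hypothesis phi0 : inI I (phi 0 *m fraug F - u *: fraug G).
Hypothesis phid : forall i, frd G i *m phi i = phi i.+1 *m frd F i.

(** The cone of [phi], with [G] shifted by [d] in internal degree and by 1 in homological degree. It
    comes from the exact sequence [0 -> S/J -> S/I -> S/(I + (u)) -> 0], whose first map is
    multiplication by [u]. *)
Definition cone_rank i : nat :=
  if i is i'.+1 then (frank F i'.+1 + frank G i')%N else frank F 0.

Definition cone_deg i : 'I_(cone_rank i) -> int :=
  match i with
  | 0 => fun a => frdeg a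
  | i'.+1 => fun a => match split a with inl b => frdeg b | inr c => dG c end
  end.

Definition cone_d i : 'M[S]_(cone_rank i.+1, cone_rank i) :=
  match i with
  | 0 => col_mx (frd F 0) (phi 0)
  | i'.+1 => block_mx (frd F i'.+1) 0 (phi i'.+1) (- frd G i')
  end.

Lemma cone_homog i (a : 'I_(cone_rank i.+1)) (b : 'I_(cone_rank i)) :
  homog_of_deg (cone_deg a - cone_deg b) (cone_d i a b).
Proof.
case: i a b => [|i] a b /=.
  rewrite mxE; case: (split a) => c; last exact: hphi.
  exact: frd_homog.
rewrite mxE; case: (split a) => c; rewrite mxE; case: (split b) => e.
- exact: frd_homog.
- by rewrite mxE; exact: homog0.
- exact: hphi.
- rewrite mxE; apply: homogN; rewrite /dG opprD addrACA subrr addr0.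
  exact: frd_homog.
Qed.

Lemma cone_dd i : cone_d i.+1 *m cone_d i = 0.
Proof.
have e k : phi k.+1 *m frd F k + - frd G k *m phi k = 0.
  by rewrite mulNmx phid subrr.
case: i => [|i] /=.
  by rewrite mul_block_col frd_frd mul0mx addr0 e col_mx0.
rewrite mulmx_block e !mul0mx !mulmx0 frd_frd !addr0 !add0r mulNmx mulmxN opprK.
by rewrite frd_frd -[RHS](block_mx0 _ _ _ _).
Qed.

Let u_row (y : 'rV[S]_(frank G 0)) : (y *m (u *: fraug G)) 0 0 = u * (y *m fraug G) 0 0.
Proof. by rewrite -scalemxAr mxE. Qed.

Let phi_aug (y : 'rV[S]_(frank G 0)) :
  I ((y *m phi 0 *m fraug F) 0 0 - u * (y *m fraug G) 0 0).
Proof.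
rewrite -u_row.
have -> : (y *m phi 0 *m fraug F) 0 0 - (y *m (u *: fraug G)) 0 0 =
    (y *m (phi 0 *m fraug F - u *: fraug G)) 0 0.
  by rewrite mulmxBr mulmxA !mxE.
exact: inI_mull.
Qed.

Let aug_I (w : 'rV[S]_(frank F 1)) : I ((w *m frd F 0 *m fraug F) 0 0).
Proof.
have h : inI I (w *m frd F 0 *m fraug F) by apply/(resolution_aug (F := F)); exists w.
exact: h.
Qed.

Lemma cone_surj : exists v : 'rV_(cone_rank 0), add_gen (1 - (v *m fraug F) 0 0).
Proof.
have [v vP] := fraug_surj F; exists v, 0.
by rewrite mul0r subr0.
Qed.

Lemma cone_aug_exact (v : 'rV_(cone_rank 0)) :
  add_gen ((v *m fraug F) 0 0) <-> exists w, v = w *m cone_d 0.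
Proof.
have [_ ID IM _] := hI; split=> [[s sP]|[w ->] /=].
  (* [y] represents 1 in [S/J], so [y *m phi 0] is sent to [u] modulo [I]; subtracting [s] times it
     from [v] leaves an element augmented into [I]. *)
  have [y yP] := fraug_surj G.
  have : inI I ((v - s *: (y *m phi 0)) *m fraug F).
    apply/inI_cv => a; rewrite ord1 mulmxBl -scalemxAl.
    set t := (y *m fraug G) 0 0 in yP.
    have -> : (v *m fraug F - s *: (y *m phi 0 *m fraug F)) 0 0 =
      ((v *m fraug F) 0 0 - s * u) + (s * (u * (1 - t))
        + (- s) * ((y *m phi 0 *m fraug F) 0 0 - u * t)).
      have mE (A B : 'M[S]_1) : (A - s *: B) 0 0 = A 0 0 - s * B 0 0 by rewrite !mxE.
      rewrite mE; move: (v *m fraug F) (y *m phi 0 *m fraug F) => A B.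
      rewrite mulNr -mulrBr (mulrBr u) mulr1 opprB addrA subrK.
      by rewrite mulrBr addrA subrK.
    apply: (ID _ _ sP); apply: ID; apply: IM; last exact: phi_aug.
    exact/colonJ.
  move=> /(resolution_aug (F := F))[w wE]; exists (row_mx w (s *: y)).
  by rewrite /= mul_row_col -wE -scalemxAl subrK.
rewrite -[w]hsubmxK mul_row_col mulmxDl.
exists ((rsubmx w *m fraug G) 0 0); rewrite mxE -addrA.
by apply: ID; [exact: aug_I|rewrite mulrC; exact: phi_aug].
Qed.

(** Subtracting the boundary of [row_mx 0 (- y)] removes [v2] and leaves the cycle
    [v1 + y *m phi i.+1] of [F], which is a boundary there. *)
Let cone_lift i (v1 : 'rV_(frank F i.+1)) (v2 : 'rV_(frank G i)) (y : 'rV_(frank G i.+1)) :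
  v1 *m frd F i + v2 *m phi i = 0 -> v2 = y *m frd G i ->
  exists w : 'rV_(cone_rank i.+2), row_mx v1 v2 = w *m cone_d i.+1.
Proof.
move=> e yE.
have /(resolution_frd (F := F))[x xE] : (v1 + y *m phi i.+1) *m frd F i = 0.
  by rewrite mulmxDl -mulmxA -phid mulmxA -yE.
exists (row_mx x (- y)); rewrite /= mul_row_block mulmx0 add0r !mulNmx mulmxN opprK.
by rewrite -xE addrK yE.
Qed.

Lemma cone_exact i (v : 'rV_(cone_rank i.+1)) :
  v *m cone_d i = 0 <-> exists w, v = w *m cone_d i.+1.
Proof.
split=> [|[w ->]]; last by rewrite -mulmxA cone_dd mulmx0.
case: i v => [|i] v.
  rewrite -[v]hsubmxK [_ *m _]mul_row_col => e.
  set v1 := lsubmx v in e *; set v2 := rsubmx v in e *.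
  (* This is the injectivity of multiplication by [u] from [S/J] to [S/I]. *)
  have [y yE] : exists y, v2 = y *m frd G 0.
    apply/(resolution_aug (F := G))/inI_cv => a; rewrite ord1; apply/colonJ.
    have [_ ID IM _] := hI.
    apply: (gideal_subr hI (phi_aug v2)).
    rewrite (_ : v2 *m phi 0 = - (v1 *m frd F 0)); last first.
      by apply/eqP; rewrite -addr_eq0 addrC e.
    by rewrite mulNmx mxE; apply: gidealN => //; exact: aug_I.
  exact: cone_lift e yE.
rewrite -[v]hsubmxK [_ *m _]mul_row_block mulmx0 add0r -row_mx0 => /eq_row_mx[e1 e2].
have [y yE] : exists y, rsubmx v = y *m frd G i.+1.
  by apply/(resolution_frd (F := G)); apply/eqP; rewrite -oppr_eq0 -mulmxN e2.
exact: cone_lift e1 yE.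
Qed.

Definition cone : resolution add_gen :=
  @GradedFreeResolution K n add_gen cone_rank cone_deg cone_d (fraug F)
    cone_homog (@fraug_homog _ _ _ F) cone_surj cone_aug_exact cone_exact.

(** Only [phi] could bring in constant terms, and a non-zero constant entry joins basis elements of
    equal degree. *)
Lemma cone_minimal : minimal_resolution F -> minimal_resolution G ->
  (forall i (a : 'I_(frank G i)) (b : 'I_(frank F i)), dG a <> frdeg b) ->
  minimal_resolution cone.
Proof.
move=> minF minG ne.
have phi_const i a b : (phi i a b)@_0%MM = 0.
  by apply: (homog_const (@hphi i a b)); rewrite subr_eq0; apply/eqP/ne.
move=> i a b; rewrite [frd cone i]/=; case: i a b => [|i] a b /=.
  rewrite mxE; case: (split a) => c; last exact: phi_const.
  exact: minF.
rewrite mxE; case: (split a) => c; rewrite mxE; case: (split b) => e.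
- exact: minF.
- by rewrite mxE mcoeff0.
- exact: phi_const.
- by rewrite mxE mcoeffN minG oppr0.
Qed.

Lemma cone_betti i j : betti cone i j =
  (betti F i j + if i is i'.+1 then betti G i' (j - (d : int)) else 0)%N.
Proof.
case: i => [|i]; first by rewrite addn0.
rewrite /betti -!sum1dep_card /= big_mkcond /= big_split_ord /=.
congr (_ + _)%N; rewrite [RHS]big_mkcond /=; apply: eq_bigr => a _.
  by rewrite -[lshift _ a]/(unsplit (inl a)) unsplitK.
rewrite -[rshift _ a]/(unsplit (inr a)) unsplitK.
by rewrite [in RHS]eq_sym subr_eq eq_sym.
Qed.

End MappingCone.

(** * Linear quotients *)

Section LinearQuotients.
Variables (K : fieldType) (n : nat).
Local Notation S := {mpoly K[n]}.
Local Notation resolution := (@graded_free_resolution K n).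
Implicit Types (A B F u v : {set 'I_n}) (X Y : {set {set 'I_n}}) (k l : 'I_n).
Implicit Types (I J : set S) (m : 'X_{1..n}).

(** Keeps a minimal resolution together with its numbers, since the next mapping cone is built on
    it. *)
Definition has_betti I (b : nat -> int -> nat) : Prop :=
  exists2 F : resolution I, minimal_resolution F & forall i j, betti F i j = b i j.

Lemma has_bettiE I b i j : graded_ideal I -> has_betti I b -> graded_betti I i j = b i j.
Proof. by move=> hI [F minF <-]; exact: graded_bettiE. Qed.

Lemma cone_has_betti I J (u : S) (d : nat) (b c : nat -> int -> nat) :
  graded_ideal I -> homog_of_deg (d : int) u -> (forall p, J p <-> I (u * p)) ->
  (forall i s t, c i s != 0%N -> b i t != 0%N -> s + (d : int) <> t) ->
  has_betti I b -> has_betti J c ->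
  has_betti (add_gen I u)
    (fun i j => b i j + if i is i'.+1 then c i' (j - (d : int))%R else 0)%N.
Proof.
move=> hI hu colon ne [F minF Fb] [G minG Gc].
have [phi [h1 h2 h3]] := exists_lift F G hI hu (fun p => (colon p).1).
exists (cone hI colon h1 h2 h3); last first.
  by move=> i j; rewrite cone_betti Fb; case: i => // i; rewrite Gc.
apply: cone_minimal => // i a e; apply: (ne i (frdeg a) (frdeg e)).
  by rewrite -Gc -lt0n; apply/card_gt0P; exists a; rewrite inE.
by rewrite -Fb -lt0n; apply/card_gt0P; exists e; rewrite inE.
Qed.

Lemma mideal_graded X : graded_ideal (@mideal K n X).
Proof.
split=> [m|p q hp hq m|p q hq m|d p hp m]; first by rewrite msupp0.
- by move=> /msuppD_le; rewrite mem_cat => /orP[/hp|/hq].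
- move=> /msuppM_le /allpairsP[[m1 m2] /= [_ /hq[F FX Fm] ->]].
  exists F => //; rewrite -smon_le; apply: lepm_trans (lem_addl _ _).
  by rewrite smon_le.
- rewrite mcoeff_msupp mcoeff_hcomp; case: ifP; last by rewrite eqxx.
  by rewrite -mcoeff_msupp => _; exact: hp.
Qed.

Lemma mideal_unit_betti I : (forall p, I p) -> has_betti I (fun _ _ => 0%N).
Proof.
move=> hI; pose dg (i : nat) (_ : 'I_0) : int := 0.
unshelve eexists.
  apply: (@GradedFreeResolution K n I (fun=> 0%N) dg (fun=> 0) 0).
  - by move=> i [].
  - by case.
  - by exists 0; exact: hI.
  - by move=> v; split=> // _; exists 0; rewrite !thinmx0.
  - by move=> i v; split=> [_|_]; [exists 0|]; rewrite !thinmx0.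
- by move=> i [].
- by move=> i j; apply/eqP; rewrite cards_eq0; apply/eqP/setP => -[].
Qed.

Lemma mideal0_betti :
  has_betti (@mideal K n set0) (fun i j => (i == 0%N) && (j == 0%R)).
Proof.
have m0 p : mideal set0 p <-> p = 0.
  split=> [h|-> m]; last by rewrite msupp0.
  apply/mpolyP => m; rewrite mcoeff0; apply/eqP/negPn/negP.
  by rewrite -mcoeff_msupp => /h[F]; rewrite inE.
pose dg (i : nat) (_ : 'I_(i == 0%N)) : int := 0.
unshelve eexists.
  apply: (@GradedFreeResolution K n (@mideal K n set0) (fun i => i == 0%N) dg
    (fun=> 0) (const_mx 1)).
  - by move=> i [].
  - by move=> a m; rewrite mxE msupp1 inE => /eqP->; rewrite mdeg0.
  - exists (const_mx 1); apply/m0.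
    by rewrite mxE big_ord1 !mxE mulr1 subrr.
  - move=> v; rewrite m0 mxE big_ord1 mxE mulr1; split=> [v0|[w ->]].
      by exists 0; rewrite mul0mx; apply/rowP => a; rewrite mxE (ord1 a).
    by rewrite mulmx0 mxE.
  - by move=> i v; split=> [_|_]; [exists 0|]; rewrite (@thinmx0 _ _ v) ?mul0mx.
- by move=> i [].
- case=> [|i] j; rewrite /betti /=; last first.
    by apply/eqP; rewrite cards_eq0; apply/eqP/setP => -[].
  have -> : [set a : 'I_(0%N == 0%N) | dg 0%N a == j]
      = if j == 0 then [set: 'I_(0%N == 0%N)] else set0.
    by apply/setP => a; rewrite !inE /dg eq_sym; case: ifP; rewrite inE.
  by case: ifP => _; rewrite ?cards0 // cardsT card_ord.
Qed.

Lemma mideal_setU1 X u : mideal (u |: X) = add_gen (@mideal K n X) 'X_[smon u].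
Proof.
have hU := mideal_graded (u |: X).
apply/predeqP => p; split=> [h|[s hs]]; last first.
  have [_ ID IM _] := hU; rewrite -[p](subrK (s * 'X_[smon u])).
  apply: ID; last first.
    apply: IM => m; rewrite msuppX inE => /eqP->; exists u; first exact: setU11.
    by rewrite -smon_le lepm_refl.
  by move=> m /hs[F FX Fm]; exists F => //; rewrite inE FX orbT.
pose s : S := \sum_(m <- msupp p | sqle u m) p@_m *: 'X_[(m - smon u)%MM].
have sE : s * 'X_[smon u] = \sum_(m <- msupp p | sqle u m) p@_m *: 'X_[m].
  rewrite /s mulr_suml; apply: eq_bigr => m um.
  by rewrite -scalerAl -mpolyXD submK // smon_le.
exists s; rewrite sE {1}[p]mpolyE (bigID (sqle u)) /= addrAC subrr add0r => m.
rewrite mcoeff_msupp raddf_sum /= => nz.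
have [um|um] := boolP (sqle u m).
  rewrite big1 ?eqxx // in nz => m' um'; rewrite mcoeffZ mcoeffX.
  by case: eqP => [mm'|_]; [rewrite mm' um in um'|rewrite mulr0].
have /h[F] : m \in msupp p.
  apply: contraR nz => mp; rewrite big1_seq // => m' /andP[_ m'p].
  rewrite mcoeffZ mcoeffX; case: eqP => [mm'|_]; last by rewrite mulr0.
  by rewrite -mm' m'p in mp.
by rewrite in_setU1 => /predU1P[->|FX] Fm; [rewrite Fm in um|exists F].
Qed.

Lemma sqle_addm F u m : sqle F (m + smon u)%MM = sqle (F :\: u) m.
Proof.
apply/forall_inP/forall_inP => h i; rewrite ?inE.
  move=> /andP[iu /h]; rewrite mnmDE smonE (negbTE iu).
  by rewrite addn0.
move=> iF; rewrite mnmDE smonE; have [iu|iu] := boolP (i \in u).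
  by rewrite addn1.
by rewrite addn0 h // inE iu.
Qed.

Lemma mideal_colon X Y u :
  (forall F, F \in Y -> exists2 A, A \in X & A :\: u \subset F) ->
  (forall A, A \in X -> exists2 F, F \in Y & F \subset A :\: u) ->
  forall p, @mideal K n Y p <-> mideal X ('X_[smon u] * p).
Proof.
move=> YX XY p; rewrite mulrC; split=> h m.
  rewrite (perm_mem (msuppMX _ _)) => /mapP[m' /h[F /YX[A AX AF] Fm'] ->].
  by exists A; rewrite // addmC sqle_addm (sqleS AF).
move=> mp; have /h[A /XY[F FY FA]] : (m + smon u)%MM \in msupp (p * 'X_[smon u]).
  by rewrite (perm_mem (msuppMX _ _)) addmC map_f.
by rewrite sqle_addm => /(sqleS FA) Fm; exists F.
Qed.

Lemma smon_homog u : homog_of_deg (#|u| : int) ('X_[smon u] : S).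
Proof. by move=> m; rewrite msuppX inE => /eqP->; rewrite mdeg_smon. Qed.

Definition vars (Q : {set 'I_n}) : {set {set 'I_n}} := [set [set k] | k in Q].

Lemma has_betti_ext I b b' : (forall i j, b i j = b' i j) -> has_betti I b -> has_betti I b'.
Proof. by move=> e [F minF Fb]; exists F => // i j; rewrite Fb. Qed.

(** A new variable is a non-zero-divisor modulo the others, so the colon ideal is the ideal itself:
    the cone is taken over two copies of one resolution, and Pascal's rule gives the ranks. *)
Lemma koszul_betti (Q : {set 'I_n}) :
  has_betti (@mideal K n (vars Q))
    (fun i j => if j == (i : int) then 'C(#|Q|, i) else 0)%N.
Proof.
elim/set_ind1: Q => [|k Q kQ IH].
  rewrite /vars imset0; apply: has_betti_ext mideal0_betti => i j.
  by rewrite cards0 bin0n; case: i => [|i] /=; case: eqP.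
have -> : vars (k |: Q) = [set k] |: vars Q by rewrite /vars imsetU1.
rewrite mideal_setU1.
have disj A : A \in vars Q -> A :\: [set k] = A.
  move=> /imsetP[l lQ ->]; apply/setDidPl; rewrite disjoints1 inE.
  by apply: contraNneq kQ => <-.
have colon : forall p, @mideal K n (vars Q) p <-> mideal (vars Q) ('X_[smon [set k]] * p).
  apply: mideal_colon => A AQ; exists A => //; by rewrite disj.
have := cone_has_betti (mideal_graded _) (@smon_homog [set k]) colon _ IH IH.
rewrite cards1 => h; apply: has_betti_ext (h _); last first.
  move=> i s t; have [->|//] := eqVneq s (i : int).
  have [->|//] := eqVneq t (i : int) => _ _ /eqP.
  by rewrite -subr_eq0 addrC addKr.
move=> [|i] j; first by rewrite addn0 !bin0.
rewrite cardsU1 kQ add1n binS subr_eq addrC -intS.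
by case: ifP.
Qed.

(** * Linear quotients for shifted complexes *)

Section SquarefreeStable.
Variable D : {set {set 'I_n}}.
Hypothesis Ddown : down_closed D.
Hypothesis D0 : set0 \in D.
Hypothesis Dexchange : forall A i j, i \in A -> j \notin A -> (i < j)%N ->
  A \notin D -> j |: A :\ i \notin D.

(* [#|below u|] is the minimum of [u] and [key] orders by degree, then by
   decreasing minimum. *)
Let below u : {set 'I_n} := [set k : 'I_n | [forall l in u, (k < l)%N]].
Let key u : nat := (#|u| * n.+1 + (n - #|below u|))%N.

Definition colon_vars u : {set 'I_n} :=
  [set k : 'I_n | (k \notin u) && [exists l in u, (l < k)%N]].

Let below_le u : (#|below u| <= n)%N.
Proof. by rewrite -[X in (_ <= X)%N](card_ord n) max_card. Qed.

Let key_card u v : (#|v| < #|u|)%N -> (key v < key u)%N.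
Proof.
move=> vu; rewrite /key; apply: (@leq_trans (#|v|.+1 * n.+1)%N).
  by rewrite mulSn addnC ltn_add2r ltnS leq_subr.
by apply: leq_trans (leq_addr _ _); rewrite leq_mul2r vu orbT.
Qed.

Let key_below u v : #|v| = #|u| -> (#|below u| < #|below v|)%N -> (key v < key u)%N.
Proof.
move=> e h; rewrite /key e ltn_add2l; apply: ltn_sub2l => //.
exact: leq_trans h (below_le v).
Qed.

(* Exchanging the elements of [A :\: u] for larger elements of [u] keeps a
   nonface a nonface. *)
Let exchange_into A u : A \notin D -> (#|A| <= #|u|)%N ->
  (forall k l, k \in A :\: u -> l \in u -> (k < l)%N) ->
  exists B, [/\ B \notin D, B \subset u & #|B| = #|A|].
Proof.
elim: {A}#|A :\: u| {-2}A (erefl #|A :\: u|) => [|r IH] A Ar AD Au lt.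
  by exists A; split=> //; rewrite -setD_eq0 -cards_eq0 Ar.
have /card_gt0P[k kA] : (0 < #|A :\: u|)%N by rewrite Ar.
have /card_gt0P[l lu] : (0 < #|u :\: A|)%N.
  move: Au; rewrite -(cardsID u A) -(cardsID A u) setIC leq_add2l Ar.
  exact: leq_trans.
have [kA' ku] : k \in A /\ k \notin u by move: kA; rewrite inE => /andP[].
have [lA lu'] : l \notin A /\ l \in u by move: lu; rewrite inE => /andP[].
pose A' := l |: A :\ k.
have A'u : A' :\: u = (A :\: u) :\ k.
  apply/setP => x; rewrite !inE; have [->|xl] := eqVneq x l; first by rewrite lu' andbF.
  by rewrite /= andbCA.
have A'A : #|A'| = #|A|.
  by rewrite /A' cardsU1 !inE (negbTE lA) andbF (cardsD1 k A) kA'.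
have [] := IH A'.
- by rewrite A'u; move: Ar; rewrite (cardsD1 k) kA => -[].
- by apply: Dexchange => //; exact: lt.
- by rewrite A'A.
- by move=> x y; rewrite A'u inE => /andP[_]; exact: lt.
by move=> B [BD Bu BA]; exists B; rewrite BA A'A.
Qed.

(** For [j] in [colon_vars u], exchanging the minimum of [u] for [j] gives a nonface; a minimal
    nonface [v] in it precedes [u], and [v :\: u] is contained in [[set j]]. Conversely, if
    [A :\: u] misses [colon_vars u], its elements lie below all of [u]. By [exchange_into] and
    minimality of [u], [A] has the size of [u]; having a smaller minimum, it comes after [u], a
    contradiction. *)
Lemma linear_quotients X u : X \subset min_nonfaces D -> u \in X ->
  (forall v, v \in X -> (key v <= key u)%N) ->
  (forall v, v \in min_nonfaces D -> (key v < key u)%N -> v \in X) ->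
  forall p, @mideal K n (vars (colon_vars u)) p <->
            mideal (X :\ u) ('X_[smon u] * p).
Proof.
move=> XD uX umax Xdown; have uD := subsetP XD _ uX.
have [uND _] := min_nonfacesP _ _ uD.
apply: mideal_colon => [_ /imsetP[j ju ->]|A].
  move: ju; rewrite inE => /andP[ju /exists_inP[l0 l0u l0j]].
  have [l lu lmin] := arg_minnP (fun l : 'I_n => l : nat) l0u.
  have {}lu : l \in u := lu.
  have lj : (l < j)%N := leq_ltn_trans (lmin _ l0u) l0j.
  pose u' := j |: u :\ l.
  have u'D : u' \notin D by exact: Dexchange.
  have u'u : #|u'| = #|u|.
    by rewrite /u' cardsU1 !inE (negbTE ju) andbF (cardsD1 l u) lu.
  have [v vD vu'] := exists_min_nonface u'D.
  have vu : (key v < key u)%N.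
    have [lt|ge] := ltnP #|v| #|u|; first exact: key_card.
    have -> : v = u' by apply/eqP; rewrite eqEcard vu' u'u.
    apply: key_below => //; apply: proper_card; apply/properP; split.
      apply/subsetP => k; rewrite !inE => /forall_inP h; apply/forall_inP => x.
      rewrite !inE => /predU1P[->|/andP[_ /h]//].
      exact: ltn_trans (h _ lu) lj.
    exists l; rewrite !inE.
      apply/forall_inP => x; rewrite !inE => /predU1P[->//|/andP[xl xu]].
      by rewrite ltn_neqAle lmin // andbT eq_sym; apply: contra xl => /eqP/val_inj->.
    by apply/forall_inP => /(_ l lu); rewrite ltnn.
  exists v.
    by rewrite !inE Xdown // andbT; apply: contraTneq vu => ->; rewrite ltnn.
  apply/subsetP => x; rewrite !inE => /andP[xu /(subsetP vu')].
  by rewrite !inE (negbTE xu) andbF orbF.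
rewrite !inE => /andP[Au AX]; have AD := subsetP XD _ AX.
have [AND _] := min_nonfacesP _ _ AD.
have [j jA jq] : exists2 j, j \in A :\: u & j \in colon_vars u; last first.
  by exists [set j]; rewrite ?imset_f // sub1set.
apply/exists_inP; apply: contraT; rewrite negb_exists_in => /forall_inP no.
have lt k l : k \in A :\: u -> l \in u -> (k < l)%N.
  move=> kA lu; have := no k kA; rewrite inE.
  have -> /= : k \notin u by move: kA; rewrite inE => /andP[].
  rewrite negb_exists_in => /forall_inP/(_ l lu); rewrite -leqNgt leq_eqVlt.
  case/predU1P => // /val_inj kl; move: kA; rewrite inE kl lu.
  by [].
have Aku := umax _ AX.
have Ale : (#|A| <= #|u|)%N.
  by rewrite leqNgt; apply: contraTN Aku => /key_card; rewrite -ltnNge.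
have [B [BD Bu BA]] := exchange_into AND Ale lt.
have Bu' := min_nonface_sub Ddown uD BD Bu.
have Auc : #|A| = #|u| by rewrite -BA Bu'.
have /card_gt0P[k kA] : (0 < #|A :\: u|)%N.
  rewrite card_gt0 setD_eq0; apply: contra Au => AsubU.
  by rewrite eqEcard AsubU Auc leqnn.
have kA' : k \in A by move: kA; rewrite inE => /andP[].
suff : (key u < key A)%N by rewrite ltnNge Aku.
apply: key_below => //; apply: proper_card; apply/properP; split.
  apply/subsetP => x; rewrite !inE => /forall_inP h; apply/forall_inP => y yu.
  exact: ltn_trans (h _ kA') (lt _ _ kA yu).
exists k; rewrite !inE; first by apply/forall_inP => y; exact: lt.
by apply/forall_inP => /(_ k kA'); rewrite ltnn.
Qed.

(** Besides the generator of [F_0], each [u] contributes the Koszul complex on [colon_vars u],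
    shifted by [#|u|] in internal degree and by 1 in homological degree. *)
Definition linear_quotient_betti X (i : nat) (j : int) : nat :=
  (((i == 0%N) && (j == 0%R)) + \sum_(u in X)
    if i is i'.+1 then
      if (j - (#|u| : int))%R == (i' : int) then 'C(#|colon_vars u|, i') else 0
    else 0)%N.

Lemma squarefree_stable_betti :
  has_betti (stanley_reisner_ideal K D) (linear_quotient_betti (min_nonfaces D)).
Proof.
rewrite stanley_reisner_min //.
(* Induct over the initial segments of the order by [key], removing an element of largest key. *)
suff : forall X : {set {set 'I_n}}, X \subset min_nonfaces D ->
    (forall u v, u \in X -> v \in min_nonfaces D -> (key v < key u)%N -> v \in X) ->
  has_betti (@mideal K n X) (linear_quotient_betti X) by apply.
move=> X; elim: {X}#|X| {-2}X (erefl #|X|) => [|r IH] X Xr XD Xdown.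
  move/eqP: Xr; rewrite cards_eq0 => /eqP->; apply: has_betti_ext mideal0_betti => i j.
  by rewrite /linear_quotient_betti big_set0 addn0.
have /card_gt0P[u0 u0X] : (0 < #|X|)%N by rewrite Xr.
have [u uX umax] := arg_maxnP key u0X; have {}uX : u \in X := uX.
have uD := subsetP XD _ uX; have [uND _] := min_nonfacesP _ _ uD.
have u0' : (0 < #|u|)%N.
  by rewrite card_gt0; apply: contraNneq uND => ->.
have hb : has_betti (@mideal K n (X :\ u)) (linear_quotient_betti (X :\ u)).
  apply: IH.
  - by move: Xr; rewrite (cardsD1 u) uX => -[].
  - exact: subset_trans (subD1set _ _) XD.
  - move=> v w; rewrite !in_setD1 => /andP[vu vX] wD wv; rewrite (Xdown v) // andbT.
    by apply: contraTneq wv => ->; rewrite -leqNgt; exact: umax.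
have colon := linear_quotients XD uX umax (fun v vD => Xdown u v uX vD).
(* In homological degree [i] the shifted Koszul complex lives in degree [#|u| + i]. For [i > 0] the
   resolution built so far lives in degrees [#|v| + i - 1] with [#|v| <= #|u|], and for [i = 0] in
   degree 0, while [u] is non-empty. *)
have ne (i : nat) (s t : int) :
    (if s == (i : int) then 'C(#|colon_vars u|, i) else 0)%N != 0%N ->
    linear_quotient_betti (X :\ u) i t != 0%N -> s + (#|u| : int) <> t.
  have [->|//] := eqVneq s (i : int) => _ tn e.
  move: tn; rewrite -e /linear_quotient_betti; case: i {e} => [|i].
    by rewrite big1 // addn0 add0r eqb0 /= eqz_nat -lt0n u0'.
  rewrite add0n sum_nat_eq0 => /negP; apply; apply/forall_inP => v vX.
  case: ifP => // /eqP e; have vu : (#|v| <= #|u|)%N.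
    rewrite leqNgt; apply/negP => /key_card; rewrite ltnNge => /negP; apply.
    by apply: umax; move: vX; rewrite in_setD1 => /andP[].
  by exfalso; lia.
have := cone_has_betti (mideal_graded _) (@smon_homog u) colon ne hb (koszul_betti _).
rewrite -mideal_setU1 setD1K //; apply: has_betti_ext => i j.
rewrite /linear_quotient_betti [in RHS](big_setD1 u uX) /= -addnA; congr (_ + _)%N.
by case: i => [|i]; rewrite addnC.
Qed.

End SquarefreeStable.
End LinearQuotients.

(** * Annihilator numbers and Betti numbers of the shifting *)

Lemma card_gt_ord n (l : 'I_n) : #|[set k : 'I_n | (l < k)%N]| = (n - l.+1)%N.
Proof.
rewrite -sum1dep_card -(big_mkord (fun k => l < k)%N (fun=> 1%N)).
by rewrite -(big_nat_widenl l.+1 0 n xpredT (fun=> 1%N)) // sum_nat_const_nat muln1.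
Qed.

(** With [l] counted from 0, there are [n - l - 1] vertices above [l], and [u] contains [#|u| - 1]
    of them. *)
Lemma card_colon_vars n (u : {set 'I_n}) l :
  emin_is u l -> (#|colon_vars u| + #|u| = n - l)%N.
Proof.
move=> /emin_isP[lu lmin].
have -> : colon_vars u = [set k : 'I_n | (l < k)%N] :\: u.
  apply/setP => k; rewrite !inE; congr (_ && _); apply/exists_inP/idP => [[x xu]|lk].
    by apply: leq_ltn_trans; exact: lmin.
  by exists l.
have := cardsID u [set k : 'I_n | (l < k)%N]; rewrite card_gt_ord.
have -> : [set k : 'I_n | (l < k)%N] :&: u = u :\ l.
  apply/setP => k; rewrite !inE andbC; have [ku|] := boolP (k \in u); last by rewrite andbF.
  by rewrite andbT ltn_neqAle lmin // andbT eq_sym.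
rewrite (cardsD1 l u) lu; have := ltn_ord l.
move: #|_ :\: u| #|u :\ l| => p q; move: (nat_of_ord l) => t. lia.
Qed.

Theorem proposition3p12 (K : fieldType) (n : nat)
    (Kinf : infinite_set [set: K]%classic)
    (K' : fieldType) (iota : {rmorphism K -> K'})
    (a : 'M[K']_n) (ha : alg_indep iota a)
    (Delta : {set {set 'I_n}}) (hDelta : simplicial_complex Delta) :
  let Delta_e := ext_shift a Delta in
  (forall (l : 'I_n) (j : int),
     generic_annihilator_number (face_ideal K Delta) l j
       = count_pmon_gens (stanley_reisner_ideal K Delta_e) (j + 1) l
     /\ count_pmon_gens (stanley_reisner_ideal K Delta_e) (j + 1) l
       = count_emon_gens (face_ideal K Delta_e) (j + 1) l) /\
  (forall (i : nat) (j : int), (1 <= i)%N ->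
     (graded_betti (stanley_reisner_ideal K Delta_e) i (i%:Z + j))%:Z
       = \sum_(l < n) binz (n%:Z - l.+1%:Z - j) (i - 1)
           * (generic_annihilator_number (face_ideal K Delta) l j)%:Z).
Proof.
move=> De; have [Ddown Dv] := hDelta.
have Dedown : down_closed De := ext_shift_down Ddown Kinf ha.
have Deex : forall (A : {set 'I_n}) (i j : 'I_n), i \in A -> j \notin A -> (i < j)%N ->
    A \notin De -> j |: A :\ i \notin De.
  by move=> A i j; exact: (ext_shift_exchange Ddown Kinf ha).
have alphaE l j : generic_annihilator_number (face_ideal K Delta) l j =
    #|[set u in min_nonfaces De | ((#|u| : int) == j + 1) && emin_is u l]|.
  rewrite /generic_annihilator_number (gin_face_ideal Ddown Kinf ha).
  exact: alpha_min_nonfaces.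
split=> [l j|i j i0]; first by rewrite alphaE count_pmon_gensE // count_emon_gensE.
(* A vertex would make the empty set a face, so the exceptional case has [n = 0] and no faces: the
   sum is empty, and the quotient by the whole ring has the zero resolution. *)
have [D0|D0] := boolP (set0 \in Delta); last first.
  have n0 : n = 0%N.
    case: n a ha Delta hDelta {De Dedown Deex alphaE} Ddown Dv D0 => // n' a' _ D' _ Ddown Dv.
    by case/negP; apply: Ddown (Dv ord0) _; exact: sub0set.
  have De0 : set0 \notin De.
    apply/(ext_shiftP Ddown)/initial_at_card => F FD.
    by case/negP: D0; apply: Ddown FD _; exact: sub0set.
  rewrite big1 => [|l _]; last by case: l => m lt; exfalso; rewrite n0 in lt.
  have hI p : stanley_reisner_ideal K De p.
    rewrite stanley_reisnerE => m _; exists set0; first by rewrite inE.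
    by apply/forall_inP => k; rewrite inE.
  have hg : graded_ideal (stanley_reisner_ideal K De).
    by rewrite stanley_reisnerE; exact: mideal_graded.
  by rewrite (has_bettiE _ _ hg (mideal_unit_betti hI)).
have De0 : set0 \in De by exact: (ext_shift_set0 Ddown).
have hg : graded_ideal (stanley_reisner_ideal K De).
  by rewrite stanley_reisnerE; exact: mideal_graded.
rewrite (has_bettiE _ _ hg (squarefree_stable_betti K Dedown De0 Deex)).
case: i i0 => // i _; rewrite subn1 /linear_quotient_betti add0n /=.
under [RHS]eq_bigr do rewrite alphaE.
pose M := min_nonfaces De.
have minE (u : {set 'I_n}) : u \in M -> exists l, emin_is u l.
  move=> uM; have /set0Pn[x xu] : u != set0.
    by apply: contraTneq uM => ->; rewrite inE De0.
  have [l lu lmin] := arg_minnP (fun l : 'I_n => l : nat) xu.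
  by exists l; apply/emin_isP; split=> // k /lmin.
have min_uniq (u : {set 'I_n}) l l' : emin_is u l -> emin_is u l' -> l = l'.
  move=> /emin_isP[lu h] /emin_isP[l'u h']; apply/val_inj/eqP.
  by rewrite eqn_leq h // h'.
pose f (u : {set 'I_n}) : nat := if (#|u| : int) == j + 1 then 'C(#|colon_vars u|, i) else 0.
transitivity ((\sum_(u in M) f u)%N : int).
  congr Posz; apply: eq_bigr => u _; rewrite /f.
  suff -> : (i.+1%:Z + j - #|u|%:Z == i) = (#|u|%:Z == j + 1) by [].
  by apply/eqP/eqP; lia.
(* Sort the minimal nonfaces by their minimum, which exists because the empty set is a face. *)
transitivity ((\sum_(l < n) \sum_(u in M | emin_is u l) f u)%N : int).
  congr Posz; rewrite (exchange_big_dep (mem M)) /=; last by move=> l u _ /andP[].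
  apply: eq_bigr => u uM; have [l ul] := minE u uM.
  rewrite (bigD1 l) ?uM //= big1 ?addn0 // => l' /andP[ul' /eqP[]].
  exact: min_uniq ul' ul.
have PoszS := big_morph Posz PoszD (erefl (Posz 0)).
rewrite PoszS; apply: eq_bigr => l _.
rewrite PoszS -sum1_card PoszS mulr_sumr big_mkcond [RHS]big_mkcond.
apply: eq_bigr => u _; rewrite inE andbC -/M /f.
have [uM|uM] := boolP (u \in M); last by rewrite andbF.
have [ul|ul] := boolP (emin_is u l); last by rewrite !andbF.
rewrite /= !andbT; case: eqP => // uj.
(* Wherever some [u] is counted, the upper entry of the binomial coefficient is the number of its
   colon variables, so [binz] is evaluated at a natural number. *)
have -> : n%:Z - l.+1%:Z - j = #|colon_vars u|%:Z.
  move: uj (card_colon_vars ul) (ltn_ord l).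
  move: #|u| #|colon_vars u| (nat_of_ord l) => p q t. lia.
by rewrite /= mulr1.
Qed.
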